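(* Let $\mathcal{P}$ be an ADP problem and let $\mathcal{P}_1,\dots,\mathcal{P}_n$ ($n\ge 0$) be the SCCs of the $\mathcal{P}$-dependency graph. Then $\mathcal{P}$ is iAST if and only if $\mathcal{P}_i\cup\flat(\mathcal{P}\setminus\mathcal{P}_i)$ is iAST for every $1\le i\le n$. (That is, the processor $\mathrm{Proc}_{\mathtt{DG}}(\mathcal{P})=\{\mathcal{P}_1\cup\flat(\mathcal{P}\setminus\mathcal{P}_1),\dots,\mathcal{P}_n\cup\flat(\mathcal{P}\setminus\mathcal{P}_n)\}$ is sound and complete.)
   Context: Fix a finite signature $\Sigma=\mathcal{D}\uplus\mathcal{C}$ (defined symbols and constructors) and a set of variables $\mathcal{V}$; all left-hand sides of ADPs have root in $\mathcal{D}$. For each $f\in\mathcal{D}$ let $f^\#$ be a fresh symbol of the same arity, $\mathcal{D}^\#=\{f^\#\mid f\in\mathcal{D}\}$, $\Sigma^\#=\Sigma\uplus\mathcal{D}^\#$; elements of $\mathcal{T}(\Sigma^\#,\mathcal{V})$ are annotated terms. $\mathrm{pos}_{\Sigma'}(t)$ is the set of positions of $t$ carrying a symbol of $\Sigma'$. For $\Phi\subseteq\mathrm{pos}_{\mathcal{D}\cup\mathcal{D}^\#}(t)$, $\#_\Phi(t)$ annotates exactly the symbols at positions in $\Phi$ and removes all other annotations; $\flat(t)=\#_\emptyset(t)$ (extended to multi-distributions, ADPs and sets of ADPs termwise); $t^\#=\#_{\{\varepsilon\}}(t)$; $\flat_{\uparrow\pi}(t)$ removes all annotations strictly above position $\pi$.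 $t\trianglelefteq_\# s$ means $t=\flat(s|_\pi)$ for some $\pi\in\mathrm{pos}_{\mathcal{D}^\#}(s)$. A finite multi-distribution on $A\neq\emptyset$ is a finite multiset $\mu$ of pairs $(p:a)$, $0<p\le1$, $a\in A$, with probabilities summing to 1; $\mathrm{Supp}(\mu)$ is the multiset of its elements. An ADP is $\ell\to\{p_1:r_1,\dots,p_k:r_k\}^m$ with $\ell\in\mathcal{T}(\Sigma,\mathcal{V})\setminus\mathcal{V}$, $m\in\{\mathsf{true},\mathsf{false}\}$, $\{p_1:r_1,\dots,p_k:r_k\}$ a finite multi-distribution on $\mathcal{T}(\Sigma^\#,\mathcal{V})$, $\mathcal{V}(r_j)\subseteq\mathcal{V}(\ell)$. An ADP problem is a finite set $\mathcal{P}$ of ADPs. An annotated term $t$ is a $\mathcal{P}$-normal form if no subterm of $\flat(t)$ is an instance of a left-hand side of $\mathcal{P}$; $\mathtt{ANF}_{\mathcal{P}}$ is the set of annotated terms whose proper subterms are all $\mathcal{P}$-normal forms. $s\hookrightarrow_{\mathcal{P}}\{p_1:t_1,\dots,p_k:t_k\}$ holds if there are an ADP $\ell\to\{p_1:r_1,\dots,p_k:r_k\}^m\in\mathcal{P}$, a substitution $\sigma$ and $\pi\in\mathrm{pos}_{\mathcal{D}\cup\mathcal{D}^\#}(s)$ with $\flat(s|_\pi)=\ell\sigma\in\mathtt{ANF}_{\mathcal{P}}$ such that for all $j$: (pr) $t_j=s[r_j\sigma]_\pi$ if $\pi\in\mathrm{pos}_{\mathcal{D}^\#}(s)$, $m=\mathsf{true}$;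 (p) $t_j=\flat_{\uparrow\pi}(s[r_j\sigma]_\pi)$ if $\pi\in\mathrm{pos}_{\mathcal{D}^\#}(s)$, $m=\mathsf{false}$; (r) $t_j=s[\flat(r_j)\sigma]_\pi$ if $\pi\notin\mathrm{pos}_{\mathcal{D}^\#}(s)$, $m=\mathsf{true}$; (irr) $t_j=\flat_{\uparrow\pi}(s[\flat(r_j)\sigma]_\pi)$ if $\pi\notin\mathrm{pos}_{\mathcal{D}^\#}(s)$, $m=\mathsf{false}$. A $\mathcal{P}$-chain tree (CT) is $\mathfrak{T}=(V,E,L,V_P)$: (1) $(V,E)$ a (possibly infinite) directed tree, $V\neq\emptyset$, every node with finitely many children; (2) $L$ labels each node $v$ with $(p_v,t_v)\in(0,1]\times\mathcal{T}(\Sigma^\#,\mathcal{V})$, $p_v=1$ at the root; (3) $V_P$ is a set of inner nodes, $V_R$ the remaining inner nodes; (4) if $v\in V_P$ has children $w_1,\dots,w_k$ then $t_v\hookrightarrow_{\mathcal{P}}\{\frac{p_{w_1}}{p_v}:t_{w_1},\dots,\frac{p_{w_k}}{p_v}:t_{w_k}\}$ by case (pr) or (p); (5) likewise for $v\in V_R$ by case (r) or (irr); (6) every infinite path contains infinitely many nodes of $V_P$. $|\mathfrak{T}|_{\mathtt{Leaf}}$ is the sum of $p_v$ over all leaves $v$. $\mathcal{P}$ is iAST if $|\mathfrak{T}|_{\mathtt{Leaf}}=1$ for every $\mathcal{P}$-CT. $\mathrm{np}(\mathcal{P})$ is the ordinary TRS $\{\ell\to\flat(r_j)\mid \ell\to\{p_1:r_1,\dots,p_k:r_k\}^{\mathsf{true}}\in\mathcal{P},1\le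 j\le k\}$; $\overset{i}{\to}_{\mathrm{np}(\mathcal{P})}$ is innermost rewriting with it (annotated symbols being treated as ordinary symbols distinct from their unannotated versions). The $\mathcal{P}$-dependency graph has node set $\mathcal{P}$ and an edge from $\ell_1\to\{p_1:r_1,\dots,p_k:r_k\}^m$ to $\ell_2\to\dots$ if there are substitutions $\sigma_1,\sigma_2$ and $t\trianglelefteq_\# r_j$ for some $j$ with $t^\#\sigma_1\overset{i}{\to}{}^*_{\mathrm{np}(\mathcal{P})}\ell_2^\#\sigma_2$ and $\ell_1\sigma_1,\ell_2\sigma_2\in\mathtt{ANF}_{\mathcal{P}}$. An SCC is a maximal set $\mathcal{P}'$ of nodes such that for any (not necessarily distinct) $\alpha,\beta\in\mathcal{P}'$ there is a non-empty path from $\alpha$ to $\beta$ traversing only nodes of $\mathcal{P}'$. *)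

(* Defs.v *)
From HB Require Import structures.
From Stdlib Require Import Relation_Operators.
From mathcomp Require Import all_boot all_order all_algebra.
From mathcomp Require Import finmap multiset.
From mathcomp Require Import all_classical all_reals ereal esum.

Set Implicit Arguments.
Unset Strict Implicit.
Unset Printing Implicit Defensive.

Import Order.TTheory GRing.Theory Num.Theory.
Local Open Scope classical_set_scope.
Local Open Scope ring_scope.

(* Arguments are plain functions, so equality of terms is extensional only up
   to functional extensionality, which MathComp-Analysis assumes anyway. *)
Inductive term (F : Type) (ar : F -> nat) (V : Type) : Type :=
| Var of V
| App (f : F) of ('I_(ar f) -> term ar V).
Arguments Var {F ar V}.
Arguments App {F ar V}.

(* Classical equality and choice, needed to form multisets of terms. *)
HB.instance Definition _ F (ar : F -> nat) V := gen_eqMixin (term ar V).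
HB.instance Definition _ F (ar : F -> nat) V := gen_choiceMixin (term ar V).

Section Terms.
Context {F : Type} {ar : F -> nat} {V : Type}.
Implicit Types (s t u l r : term ar V) (p : seq nat).

Fixpoint vars t : set V :=
  match t with
  | Var x => [set x]
  | App f a => [set x | exists i, vars (a i) x]
  end.

Definition root_sym t : option F :=
  match t with Var _ => None | App f _ => Some f end.

Fixpoint subst W (sigma : V -> term ar W) t : term ar W :=
  match t with
  | Var x => sigma x
  | App f a => App f (fun i => subst sigma (a i))
  end.

(* Positions are lists of argument indices, counted from 0; [::] is the root.
   [subterm_at t p] is None when p is not a position of t. *)
Fixpoint subterm_at t p : option (term ar V) :=
  match p, t with
  | [::], _ => Some t
  | i :: q, App f a =>
      if insub i is Some j then subterm_at (a j) q else None
  | _ :: _, Var _ => None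
  end.

Definition sym_at t p : option F := obind root_sym (subterm_at t p).

Fixpoint replace t p u : term ar V :=
  match p, t with
  | [::], _ => u
  | i :: q, App f a =>
      App f (fun j => if val j == i then replace (a j) q u else a j)
  | _ :: _, Var x => Var x
  end.

Definition normal_form (L : set (term ar V)) t : Prop :=
  forall p u, subterm_at t p = Some u ->
  ~ exists l sigma, L l /\ u = subst sigma l.

Definition innermost_step (RR : set (term ar V * term ar V)) s t : Prop :=
  exists l r sigma p,
    [/\ RR (l, r),
        subterm_at s p = Some (subst sigma l),
        forall q u, q != [::] -> subterm_at (subst sigma l) q = Some u ->
          normal_form (fst @` RR) u
      & t = replace s p (subst sigma r)].

End Terms.

Record signature := Signature {
  defs : finType;
  ctors : finType;
  arity : defs + ctors -> nat
}.

Definition sym (Sg : signature) := (defs Sg + ctors Sg)%type.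

(* [inl f] is the symbol f itself, [inr f] is f^#. *)
Definition asym (Sg : signature) := (sym Sg + defs Sg)%type.

Definition flat_sym (Sg : signature) (f : asym Sg) : sym Sg :=
  match f with inl g => g | inr d => inl d end.

Definition aarity (Sg : signature) (f : asym Sg) : nat := arity (flat_sym f).

Notation uterm Sg V := (term (@arity Sg) V).
Notation aterm Sg V := (term (@aarity Sg) V).

Section Annotations.
Context {Sg : signature} {V : Type}.

Fixpoint flat (t : aterm Sg V) : uterm Sg V :=
  match t with
  | Var x => Var x
  | App f a => App (flat_sym f) (fun i => flat (a i))
  end.

(* The inclusion of T(Sigma,V) into T(Sigma^#,V); thus flattening, as an
   operation on annotated terms, is [emb \o flat]. *)
Fixpoint emb (t : uterm Sg V) : aterm Sg V :=
  match t with
  | Var x => Var x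
  | App f a => App (inl f : asym Sg) (fun i => emb (a i))
  end.

(* t^# *)
Definition sharp (t : uterm Sg V) : aterm Sg V :=
  match t with
  | Var x => Var x
  | App (inl d) a => App (inr d : asym Sg) (fun i => emb (a i))
  | App (inr c) a => App (inl (inr c) : asym Sg) (fun i => emb (a i))
  end.

Fixpoint flat_above (p : seq nat) (t : aterm Sg V) : aterm Sg V :=
  match p, t with
  | i :: q, App f a =>
      App (inl (flat_sym f) : asym Sg)
          (fun j => if val j == i then flat_above q (a j) else a j)
  | _, _ => t
  end.

Definition pos_annot (t : aterm Sg V) : set (seq nat) :=
  [set p | exists d : defs Sg, sym_at t p = Some (inr d)].

Definition pos_def (t : aterm Sg V) : set (seq nat) :=
  [set p | exists d : defs Sg,
     sym_at t p = Some (inl (inl d)) \/ sym_at t p = Some (inr d)].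

Definition annot_sub (t : uterm Sg V) (s : aterm Sg V) : Prop :=
  exists p u, [/\ pos_annot s p, subterm_at s p = Some u & t = flat u].

Definition asubst (sigma : V -> uterm Sg V) (t : aterm Sg V) : aterm Sg V :=
  subst (emb \o sigma) t.

End Annotations.

Definition mset_map (A B : choiceType) (f : A -> B) (mu : {mset A}%mset) :
  {mset B}%mset := seq_mset [seq f x | x <- mu].

Definition multi_distribution (R : realType) (A : choiceType)
    (mu : {mset R * A}%mset) : Prop :=
  (forall x, x \in mu -> 0 < x.1 <= 1) /\ \sum_(x <- mu) x.1 = 1.

(* Raw triples; the conditions on an ADP are in [is_adp]. *)
Record adp (R : realType) (Sg : signature) (V : Type) := ADP {
  lhs : uterm Sg V;
  rhs : {mset R * aterm Sg V}%mset;
  flag : bool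
}.

Section ADPProblems.
Context {R : realType} {Sg : signature} {V : Type}.
Implicit Types (al be : adp R Sg V) (P Q : set (adp R Sg V)).
Implicit Types (s t r : aterm Sg V) (sigma : V -> uterm Sg V).

Definition is_adp al : Prop :=
  [/\ exists d : defs Sg, root_sym (lhs al) = Some (inl d),
      multi_distribution (rhs al)
    & forall x, x \in rhs al -> vars x.2 `<=` vars (lhs al)].

Definition adp_problem P : Prop := finite_set P /\ P `<=` [set al | is_adp al].

Definition flat_adp al : adp R Sg V :=
  ADP (lhs al) (mset_map (fun x => (x.1, emb (flat x.2))) (rhs al)) (flag al).

Definition adp_nf P t : Prop := normal_form (@lhs R Sg V @` P) (flat t).

Definition ANF P : set (aterm Sg V) :=
  [set t | forall p u, p != [::] -> subterm_at t p = Some u -> adp_nf P u].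

Definition redex P s al sigma (p : seq nat) : Prop :=
  [/\ P al, pos_def s p,
      exists2 u, subterm_at s p = Some u & flat u = subst sigma (lhs al)
    & ANF P (emb (subst sigma (lhs al)))].

Variant step_case := case_pr | case_p | case_r | case_irr.

Inductive adp_step P s : step_case -> {mset R * aterm Sg V}%mset -> Prop :=
| step_pr al sigma p : redex P s al sigma p -> pos_annot s p -> flag al ->
    adp_step P s case_pr
      (mset_map (fun x => (x.1, replace s p (asubst sigma x.2))) (rhs al))
| step_p al sigma p : redex P s al sigma p -> pos_annot s p -> ~~ flag al ->
    adp_step P s case_p
      (mset_map (fun x =>
         (x.1, flat_above p (replace s p (asubst sigma x.2)))) (rhs al))
| step_r al sigma p : redex P s al sigma p -> ~ pos_annot s p -> flag al ->
    adp_step P s case_r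
      (mset_map (fun x =>
         (x.1, replace s p (asubst sigma (emb (flat x.2))))) (rhs al))
| step_irr al sigma p : redex P s al sigma p -> ~ pos_annot s p -> ~~ flag al ->
    adp_step P s case_irr
      (mset_map (fun x =>
         (x.1, flat_above p (replace s p (asubst sigma (emb (flat x.2))))))
         (rhs al)).

End ADPProblems.

(* The node set is the whole type N. *)
Record labelled_tree (R : realType) (Sg : signature) (V : Type)
    (N : choiceType) := LabelledTree {
  edge : N -> N -> Prop;
  prob : N -> R;
  label : N -> aterm Sg V;
  nodesP : set N
}.

Definition directed_tree (N : Type) (E : N -> N -> Prop) (r : N) : Prop :=
  [/\ forall v, ~ E v r,
      forall u v w, E u w -> E v w -> u = v
    & forall v, clos_refl_trans N E r v].

Section ChainTrees.
Context {R : realType} {Sg : signature} {V : Type} {N : choiceType}.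
Implicit Types (P : set (adp R Sg V)) (T : labelled_tree R Sg V N) (v : N).

Definition children T v : set N := [set w | edge T v w].

Definition leaf T : set N := [set v | children T v = set0].

Definition child_distr T v : {mset R * aterm Sg V}%mset :=
  seq_mset [seq (prob T w / prob T v, label T w) | w <- fset_set (children T v)].

Definition chain_tree P T : Prop :=
  (exists2 r, directed_tree (edge T) r & prob T r = 1) /\
  [/\ forall v, finite_set (children T v),
      forall v, 0 < prob T v <= 1,
      nodesP T `<=` ~` leaf T,
      (forall v, nodesP T v ->
         adp_step P (label T v) case_pr (child_distr T v) \/
         adp_step P (label T v) case_p (child_distr T v)) /\
      (forall v, ~ leaf T v -> ~ nodesP T v ->
         adp_step P (label T v) case_r (child_distr T v) \/
         adp_step P (label T v) case_irr (child_distr T v))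
    & forall w : nat -> N, (forall n, edge T (w n) (w n.+1)) ->
        forall n, exists2 m, (n <= m)%N & nodesP T (w m)].

Definition leaf_prob T : \bar R := \esum_(v in leaf T) (prob T v)%:E.

End ChainTrees.

Definition iAST (R : realType) (Sg : signature) (V : Type)
    (P : set (adp R Sg V)) : Prop :=
  forall (N : choiceType) (T : labelled_tree R Sg V N),
    chain_tree P T -> leaf_prob T = 1%E.

Section DependencyGraph.
Context {R : realType} {Sg : signature} {V : Type}.
Implicit Types (al be : adp R Sg V) (P Q : set (adp R Sg V)).

(* The rules are embedded into annotated terms, because rewriting takes place
   on terms with an annotated root. *)
Definition np P : set (aterm Sg V * aterm Sg V) :=
  [set lr | exists al x, [/\ P al, flag al, x \in rhs al &
              lr = (emb (lhs al), emb (flat x.2))]].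

Definition dg_edge P al be : Prop :=
  P al /\ P be /\
  exists (sigma1 sigma2 : V -> uterm Sg V) (x : R * aterm Sg V) (t : uterm Sg V),
    [/\ x \in rhs al, annot_sub t x.2,
        clos_refl_trans _ (innermost_step (np P))
          (asubst sigma1 (sharp t)) (asubst sigma2 (sharp (lhs be))),
        ANF P (emb (subst sigma1 (lhs al)))
      & ANF P (emb (subst sigma2 (lhs be)))].

Definition strongly_connected P Q : Prop :=
  forall al be, Q al -> Q be ->
    clos_trans _ (fun a b => [/\ Q a, Q b & dg_edge P a b]) al be.

(* Non-emptiness is explicit: otherwise the empty set would be the only SCC of
   an acyclic graph. *)
Definition SCC P Q : Prop :=
  [/\ Q !=set0, Q `<=` P, strongly_connected P Q
    & forall Q', Q `<=` Q' -> Q' `<=` P -> strongly_connected P Q' -> Q' = Q].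

End DependencyGraph.

(* Main.v *)
(** Soundness. Let [T] be a chain tree of [P]. Along an infinite path of [T],
    every annotation that is consumed late enough was created by an earlier
    annotated step, and the two ADPs are joined by an edge of the dependency
    graph. Choosing among the ADPs used infinitely often one that is minimal
    for reachability, the path from some node [u] on uses infinitely often
    annotations that are created and consumed inside a single SCC [Q]: if the
    labels are restarted at [u] and the ADPs outside [Q] are flattened, the
    path still meets infinitely many annotated redexes. There are countably
    many pairs [(u, Q)], so it is enough that for each of them such paths form
    a null set. Otherwise, pruning the tree below [u] at suitable depths would
    give a chain tree of the processed problem with leaf probability below 1.
    Null sets are handled without a measure on paths: a set of paths is null
    if it is covered by sets of nodes of arbitrarily small probability, and by
    König's lemma the set of all infinite paths is null only if the leaves have
    total probability 1.

    Completeness. Restoring the annotations erased from a processed problem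
    turns each of its chain trees into a chain tree of [P] of the same shape. *)

Require Import Defs.
From Stdlib Require Import Relation_Operators Operators_Properties.
From mathcomp Require Import all_boot all_order all_algebra.
From mathcomp Require Import finmap multiset.
From mathcomp Require Import all_classical all_reals ereal esum.
From mathcomp Require Import zify ring lra.

Set Implicit Arguments.
Unset Strict Implicit.
Unset Printing Implicit Defensive.

Import Order.TTheory GRing.Theory Num.Theory.
Local Open Scope classical_set_scope.
Local Open Scope ring_scope.

(** * Sequences, finite sums and unbounded sets *)

Lemma prefix_anti (T : eqType) (s1 s2 : seq T) :
  prefix s1 s2 -> prefix s2 s1 -> s1 = s2.
Proof.
by move=> /size_prefix s12; rewrite prefixE take_oversize// => /eqP.
Qed.

Lemma perm_map_factor (A B C : eqType) (b0 : B) (g : A -> C) (h : B -> C)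
    (s : seq A) (X : seq B) :
  uniq s -> perm_eq (map g s) (map h X) ->
  exists2 f : A -> B, perm_eq (map f s) X & {in s, forall w, g w = h (f w)}.
Proof.
elim: s X => [|c s IH] X /=.
  by move=> _ /perm_size; case: X => // _; exists (fun=> b0).
move=> /andP[cs us] gX.
have /mapP[x xX gc] : g c \in map h X by rewrite -(perm_mem gX) mem_head.
have Xx := perm_to_rem xX.
have {}gX : perm_eq (map g s) (map h (rem x X)).
  by rewrite -(perm_cons (g c)) {2}gc; apply: perm_trans gX (perm_map h Xx).
have [f fX gf] := IH _ us gX.
have fE w : w \in s -> (if w == c then x else f w) = f w.
  by case: eqP => // -> cs'; rewrite cs' in cs.
exists (fun w => if w == c then x else f w).
  rewrite eqxx perm_sym (perm_trans Xx) // perm_cons perm_sym.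
  by rewrite (_ : map _ s = map f s) //; apply/eq_in_map.
by move=> w; rewrite inE; case: eqP => [-> _|_ /= ws] //; exact: gf.
Qed.

Lemma ler_sum_seq (R : numDomainType) (A : eqType) (f g : A -> R) (s : seq A) :
  {in s, forall a, f a <= g a} -> \sum_(a <- s) f a <= \sum_(a <- s) g a.
Proof. by move=> fg; rewrite big_seq [leRHS]big_seq; exact: ler_sum. Qed.

Lemma ler_sum_uniq_subset (R : numDomainType) (A : eqType) (f : A -> R)
    (s1 s2 : seq A) :
  uniq s1 -> {subset s1 <= s2} -> (forall a, 0 <= f a) ->
  \sum_(a <- s1) f a <= \sum_(a <- s2) f a.
Proof.
move=> us1 s12 f0.
have /count_subseqP[s ss2 s1s] a : (count_mem a s1 <= count_mem a s2)%N.
  rewrite count_uniq_mem//; case: (boolP (a \in s1)) => //= /s12.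
  by rewrite -has_pred1 has_count.
have [s3 s2E] := perm_to_subseq ss2.
by rewrite (perm_big _ s2E) big_cat (perm_big _ s1s) lerDl sumr_ge0.
Qed.

Lemma sum_half_powers_lt (R : realFieldType) (eps : R) n :
  0 < eps -> \sum_(i < n) eps / 2 ^+ i.+1 < eps.
Proof.
move=> eps0; have -> : \sum_(i < n) eps / 2 ^+ i.+1 = eps - eps / 2 ^+ n.
  elim: n => [|n IH]; first by rewrite big_ord0 expr0 divr1 subrr.
  rewrite big_ord_recr /= IH exprS; field.
  by rewrite expf_neq0.
by rewrite ltrBlDr ltrDl divr_gt0// exprn_gt0.
Qed.

Definition unbounded (S : set nat) : Prop :=
  forall n, exists2 m, (n <= m)%N & S m.

Lemma unboundedP (S : set nat) : unbounded S <-> infinite_set S.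
Proof.
split=> [uS fS|iS n].
  have [m] := uS (\max_(i <- fset_set S) i).+1.
  rewrite leqNgt ltnS => /negP + Sm; apply; apply: leq_bigmax_seq => //.
  by rewrite in_fset_set ?inE.
apply: contrapT => noS; apply: iS; apply: sub_finite_set (finite_II n) => m Sm.
by rewrite /= ltnNge; apply/negP => nm; apply: noS; exists m.
Qed.

Lemma eventually_unbounded_fiber (T : Type) (S : set nat) (f : nat -> T) :
  finite_set (f @` S) ->
  exists K, forall n, S n -> (K <= n)%N -> unbounded (S `&` f @^-1` [set f n]).
Proof.
move=> finfS.
pose bad := [set n | S n /\ ~ unbounded (S `&` f @^-1` [set f n])].
have finbad : finite_set bad.
  apply: (@sub_finite_set _ _
      (\bigcup_(a in f @` S) [set n | bad n /\ f n = a])).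
    by move=> n [Sn bn]; exists (f n) => //; exists n.
  apply: bigcup_finite => // _ [k Sk <-].
  have [[n [[Sn bn] fn]]|none] := pselect (exists n, bad n /\ f n = f k).
    move/unboundedP/contrapT: bn; apply: sub_finite_set => m [[Sm _] fm].
    by split; rewrite //= fm.
  by apply: sub_finite_set (finite_set0 _) => n bn; apply: none; exists n.
have /existsNP[K KP] : ~ unbounded bad by move=> /unboundedP; apply.
by exists K => n Sn Kn; apply: contrapT => bn; apply: KP; exists n.
Qed.

Lemma finite_set_minimal (T : Type) (le : T -> T -> Prop) (I : set T) :
  (forall a, le a a) -> (forall a b c, le a b -> le b c -> le a c) ->
  finite_set I -> I !=set0 ->
  exists2 b, I b & forall c, I c -> le c b -> le b c.
Proof.
elim/Pchoice: T => T in le I *.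
move=> lexx letr /finite_seqP[s ->] [a]; elim: s a => [//|d [|e s] IH] _ _.
  by exists d => /= [|c]; rewrite inE// => /eqP ->.
have [b bs bmin] := IH e (mem_head _ _).
have [[db nbd]|nd] := pselect (le d b /\ ~ le b d).
  exists d => /= [|c]; first exact: mem_head.
  rewrite inE => /predU1P[->//|cs] cd; apply: (letr _ _ _ db).
  by apply: bmin cs _; exact: letr db.
exists b => /= [|c]; first by rewrite inE bs orbT.
rewrite inE => /predU1P[->|cs]; last exact: bmin.
by move=> db; apply: contrapT => nbd; apply: nd.
Qed.

(** * Terms, positions and annotations *)

Section Positions.
Context {F : Type} {ar : F -> nat} {V : Type}.
Implicit Types (s t u : term ar V) (p q : seq nat).

Lemma subterm_at_nil t : subterm_at t [::] = Some t.
Proof. by case: t. Qed.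

Lemma subterm_at_cat t p q :
  subterm_at t (p ++ q) = obind (subterm_at ^~ q) (subterm_at t p).
Proof. by elim: p t => [|i p IH] [x|f a] //=; case: insub => //=. Qed.

Lemma subterm_at_subst (sigma : V -> term ar V) t u q :
  subterm_at t q = Some u ->
  subterm_at (subst sigma t) q = Some (subst sigma u).
Proof.
elim: q t => [|i q IH] [x|f a] //=; last by case: insub => // j; exact: IH.
- by move=> [<-]; rewrite subterm_at_nil.
- by move=> [<-].
Qed.

Lemma subterm_at_replace t p q u : subterm_at t p <> None ->
  subterm_at (replace t p u) (p ++ q) = subterm_at u q.
Proof.
elim: p t => [|i p IH] [x|f a] //=.
by case: insubP => //= j _ <-; rewrite eqxx; exact: IH.
Qed.

Lemma subterm_at_replace_above t p q u :
  subterm_at (replace t (p ++ q) u) p =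
  omap (fun a => replace a q u) (subterm_at t p).
Proof.
elim: p t => [|i p IH] [x|f a] //=; first by rewrite subterm_at_nil.
  by rewrite subterm_at_nil.
by case: insubP => //= j _ ji; rewrite ji eqxx.
Qed.

Lemma subterm_at_replace_parallel t p q u : ~~ prefix p q -> ~~ prefix q p ->
  subterm_at (replace t p u) q = subterm_at t q.
Proof.
elim: p q t => [|i p IH] [|k q] [x|f a] //=.
case: insubP => //= j _ ->; rewrite [i == k]eq_sym.
by case: eqP => //= _; exact: IH.
Qed.

Lemma finite_positions t : finite_set [set p | subterm_at t p <> None].
Proof.
elim: t => [x|f a IH].
  by apply: sub_finite_set (finite_set1 [::]) => -[].
apply: (@sub_finite_set _ _ ([set [::]] `|` \bigcup_(i in [set: 'I_(ar f)])
    cons (val i) @` [set p | subterm_at (a i) p <> None])).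
  move=> [|i p] /=; first by left.
  by case: insubP => // j _ <- pj; right; exists j => //; exists p.
rewrite finite_setU; split; first exact: finite_set1.
by apply: bigcup_finite => [|i _]; [exact: finite_finset|exact: finite_image].
Qed.

End Positions.

Section Annotated.
Context {Sg : signature} {V : Type}.
Implicit Types (s t u : aterm Sg V) (p q : seq nat) (e : uterm Sg V).
Implicit Types (sigma : V -> uterm Sg V).

Lemma emb_subst sigma e : emb (subst sigma e) = subst (emb \o sigma) (emb e).
Proof.
by elim: e => [x|f a IH] //=; congr App; apply/funext => i; exact: IH.
Qed.

Lemma emb_replace e p e' : emb (replace e p e') = replace (emb e) p (emb e').
Proof.
elim: p e => [|i p IH] [x|f a] //=; congr App; apply/funext => j.
by case: eqP => // _; exact: IH.
Qed.

Lemma subterm_at_emb e p :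
  subterm_at (emb e) p = omap (@emb Sg V) (subterm_at e p).
Proof. by elim: p e => [|i p IH] [x|f a] //=; case: insub => //=. Qed.

Lemma flat_emb e : flat (emb e) = e.
Proof.
by elim: e => [x|f a IH] //=; congr App; apply/funext => i; exact: IH.
Qed.

Lemma flat_subst (tau : V -> aterm Sg V) t :
  flat (subst tau t) = subst (@flat Sg V \o tau) (flat t).
Proof.
by elim: t => [x|f a IH] //=; congr App; apply/funext => i; exact: IH.
Qed.

Lemma flat_asubst sigma t : flat (asubst sigma t) = subst sigma (flat t).
Proof.
rewrite /asubst flat_subst; congr subst.
by apply/funext => x /=; rewrite flat_emb.
Qed.

Lemma flat_replace t p u : flat (replace t p u) = replace (flat t) p (flat u).
Proof.
elim: p t => [|i p IH] [x|f a] //=; congr App; apply/funext => j.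
by case: eqP => // _; exact: IH.
Qed.

Lemma flat_flat_above p t : flat (flat_above p t) = flat t.
Proof.
elim: p t => [|i p IH] [x|f a] //=; congr App; apply/funext => j.
by case: eqP => // _; exact: IH.
Qed.

Lemma subterm_at_flat t p :
  subterm_at (flat t) p = omap (@flat Sg V) (subterm_at t p).
Proof. by elim: p t => [|i p IH] [x|f a] //=; case: insub => //=. Qed.

Lemma vars_flat t : vars (flat t) = vars t.
Proof.
elim: t => [//|f a IH] /=; apply/seteqP.
by split=> x [i ax]; exists i; [rewrite -IH|rewrite IH].
Qed.

Lemma vars_emb e : vars (emb e) = vars e.
Proof. by rewrite -vars_flat flat_emb. Qed.

Lemma asubst_sharp sigma e f : root_sym e = Some f ->
  asubst sigma (sharp e) = sharp (subst sigma e).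
Proof.
case: e => //= -[d|k] g _ /=; congr App; apply/funext => i;
  by rewrite emb_subst.
Qed.

Lemma sharp_replace e p e' : p != [::] ->
  sharp (replace e p e') = replace (sharp e) p (emb e').
Proof.
case: p => // i p _; case: e => [//|[d|k] a] /=; congr App;
  by apply/funext => j; case: eqP => // _; rewrite emb_replace.
Qed.

Lemma subterm_at_sharp e p : p != [::] ->
  subterm_at (sharp e) p = omap (@emb Sg V) (subterm_at e p).
Proof.
case: p => // i p _; case: e => [//|[d|k] a] /=;
  by case: insub => //= j; rewrite subterm_at_emb.
Qed.

Definition annotated t p : bool :=
  if sym_at t p is Some (inr _) then true else false.

Lemma pos_annotP t p : reflect (pos_annot t p) (annotated t p).
Proof.
rewrite /pos_annot /annotated; case E: (sym_at t p) => [[g|d]|] /=.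
- by constructor => -[d]; rewrite E.
- by constructor; exists d; rewrite E.
- by constructor => -[d]; rewrite E.
Qed.

Lemma annotated_subterm t p : annotated t p ->
  exists u f, subterm_at t p = Some u /\ root_sym (flat u) = Some f.
Proof.
rewrite /annotated /sym_at; case: subterm_at => //= -[//|f a] _.
by exists (App f a), (flat_sym f).
Qed.

Lemma annotated_var (x : V) p : annotated (Var x : aterm Sg V) p = false.
Proof. by case: p. Qed.

Lemma annotated_cons (f : asym Sg) (a : 'I_(aarity f) -> aterm Sg V) i p :
  annotated (App f a) (i :: p) =
  if insub i is Some j then annotated (a j) p else false.
Proof. by rewrite /annotated /sym_at /=; case: insub. Qed.

Lemma annotated_emb e p : annotated (emb e) p = false.
Proof.
elim: p e => [|i p IH] [x|f a] //=.
by rewrite annotated_cons; case: insub => //= j; exact: IH.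
Qed.

Lemma annotated_asubst sigma t p : annotated (asubst sigma t) p = annotated t p.
Proof.
elim: t p => [x|f a IH] p; first by rewrite /= annotated_emb annotated_var.
case: p => [//|i p]; rewrite /= !annotated_cons.
by case: insub => // j; exact: IH.
Qed.

Lemma annotated_replace t p q u : subterm_at t p <> None ->
  annotated (replace t p u) q =
  if prefix p q then annotated u (drop (size p) q) else annotated t q.
Proof.
elim: p q t => [|i p IH] q [x|f a] //=; rewrite ?prefix0s ?drop0 //.
case: insubP => //= j _ <- pj; case: q => [//|k q] /=.
rewrite !annotated_cons; case: insubP => [l _ <-|]; last first.
  by case: eqP => //= <-; rewrite ltn_ord.
rewrite [val l == _]eq_sym; case: eqP => //= /val_inj <-; exact: IH.
Qed.

Lemma annotated_flat_above t p q :
  annotated (flat_above p t) q = annotated t q && ~~ (prefix q p && (q != p)).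
Proof.
elim: p q t => [|i p IH] q t.
  have -> : flat_above [::] t = t by case: t.
  by rewrite prefixs0; case: eqP; rewrite ?andbT.
case: t => [x|f a] /=; first by rewrite annotated_var.
case: q => [|k q]; first by rewrite /= andbF.
rewrite !annotated_cons /=; case: insubP => [j _ <-|//].
rewrite eqseq_cons; case: eqP => [_|_] /=; first exact: IH.
by rewrite andbT.
Qed.

End Annotated.

(** * Rewrite steps *)

Section Reductions.
Context {R : realType} {Sg : signature} {V : Type}.
Implicit Types (P : set (adp R Sg V)) (s u : aterm Sg V) (q : seq nat).

Record reduction := Reduction {
  rule : adp R Sg V;
  matcher : V -> uterm Sg V;
  position : seq nat
}.
Implicit Types d : reduction.

Definition redex_term d : uterm Sg V := subst (matcher d) (lhs (rule d)).

Definition reduces P s d : Prop := redex P s (rule d) (matcher d) (position d).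

Definition consumes s d : bool := annotated s (position d).

(* The four cases of the rewrite relation at once: an unannotated redex
   flattens the right-hand side, a false flag erases the annotations above. *)
Definition reduct s d u : aterm Sg V :=
  let t := replace s (position d)
    (asubst (matcher d) (if consumes s d then u else emb (flat u))) in
  if flag (rule d) then t else flat_above (position d) t.

Definition reduct_distr s d : {mset R * aterm Sg V}%mset :=
  mset_map (fun x => (x.1, reduct s d x.2)) (rhs (rule d)).

Definition consuming_case (c : step_case) : bool :=
  match c with case_pr | case_p => true | case_r | case_irr => false end.

Lemma adp_stepP P s b mu :
  (exists2 c, consuming_case c = b & adp_step P s c mu) <->
  exists d, [/\ reduces P s d, consumes s d = b & mu = reduct_distr s d].
Proof.
rewrite /reduces /reduct_distr /reduct /consumes; split.
  move=> [c <- [] al sigma p red /pos_annotP sp fl];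
    exists (Reduction al sigma p); split=> //=;
    by rewrite ?(negbTE sp) ?sp ?(negbTE fl) ?fl.
move=> [[al sigma p] /= [red + ->]].
case: (boolP (annotated s p)) => [] /pos_annotP sp <-;
  case: (boolP (flag al)) => fl.
- by exists case_pr => //; exact: step_pr.
- by exists case_p => //; exact: step_p.
- by exists case_r => //; exact: step_r.
- by exists case_irr => //; exact: step_irr.
Qed.

Lemma flat_reduct s d u :
  flat (reduct s d u) =
  replace (flat s) (position d) (subst (matcher d) (flat u)).
Proof.
rewrite /reduct; case: flag; rewrite ?flat_flat_above flat_replace flat_asubst;
  by case: consumes; rewrite ?flat_emb.
Qed.

Lemma annotated_reduct s d u q : subterm_at (flat s) (position d) <> None ->
  annotated (reduct s d u) q =
  if prefix (position d) q
  then consumes s d && annotated u (drop (size (position d)) q)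
  else annotated s q && (flag (rule d) || ~~ prefix q (position d)).
Proof.
rewrite subterm_at_flat => dom.
have {}dom : subterm_at s (position d) <> None by case: subterm_at dom.
have inner q' : annotated (asubst (matcher d)
    (if consumes s d then u else emb (flat u))) q' =
    consumes s d && annotated u q'.
  by rewrite annotated_asubst; case: consumes; rewrite ?annotated_emb.
rewrite /reduct; case: flag; first by rewrite annotated_replace// inner andbT.
rewrite annotated_flat_above annotated_replace// inner /=.
have [<-|qp] := eqVneq q (position d); first by rewrite prefix_refl andbF andbT.
rewrite andbT; case: ifP => // pq.
case: (boolP (prefix q _)) => [qp'|]; rewrite ?andbT//.
by case/eqP: qp; exact: prefix_anti.
Qed.

End Reductions.
Arguments reduction : clear implicits.

(** * Rooted trees *)

Section RootedTrees.
Context {N : choiceType}.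
Variables (E : N -> N -> Prop) (r : N).
Implicit Types (u v : N) (n : nat) (D G : set N).

Definition infinite_path : set (nat -> N) :=
  [set w | forall n, E (w n) (w n.+1)].

Definition infinitely_often D : set (nat -> N) :=
  [set w | unbounded (w @^-1` D)].

Definition hits G : set (nat -> N) := [set w | exists n, G (w n)].

Definition tip : set N := [set v | forall w, ~ E v w].

Definition hereditary G : Prop := forall v w, E v w -> G v -> G w.

Lemma not_tip v w : E v w -> ~ tip v.
Proof. by move=> vw /(_ w). Qed.

Fixpoint at_depth n v : Prop :=
  if n is m.+1 then exists2 u, at_depth m u & E u v else v = r.

Definition depth v : nat := xget 0%N [set n | at_depth n v].

Definition parent v : N := xget v [set u | E u v].

Fixpoint tree_rec_at (X : Type) (x0 : X) (g : N -> N -> X -> X) n v : X :=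
  if n is m.+1 then g (parent v) v (tree_rec_at x0 g m (parent v)) else x0.

Definition tree_rec (X : Type) (x0 : X) (g : N -> N -> X -> X) v : X :=
  tree_rec_at x0 g (depth v) v.

(* [ancestor v n] is [v] itself when [depth v < n]. *)
Definition ancestor : N -> nat -> N :=
  tree_rec (fun=> r) (fun v w anc n => if (n <= depth v)%N then anc n else w).

Hypothesis tree : directed_tree E r.

Lemma tree_ind (Q : N -> Prop) :
  Q r -> (forall v w, E v w -> Q v -> Q w) -> forall v, Q v.
Proof.
move=> Qr QE v; have [_ _ /(_ v)] := tree.
by move/clos_rt_rtn1_iff; elim => // y z yz _; exact: QE.
Qed.

Lemma at_depth_inj n m v : at_depth n v -> at_depth m v -> n = m.
Proof.
have [noroot uniq_parent _] := tree; elim: n m v => [|n IH] [|m] v //=.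
- by move=> -> [u _ /noroot].
- by move=> [u _ uv] vr; move: uv; rewrite vr => /noroot.
- move=> [u nu uv] [u' mu' u'v]; rewrite (uniq_parent _ _ _ u'v uv) in mu'.
  by rewrite (IH _ _ nu mu').
Qed.

Lemma at_depth_depth v : at_depth (depth v) v.
Proof.
suff [n nv] : exists n, at_depth n v.
  by rewrite /depth; case: xgetP => [m _|/(_ n)].
move: v; apply: tree_ind => [|v w vw [n nv]]; first by exists 0%N.
by exists n.+1; exists v.
Qed.

Lemma depth_root : depth r = 0%N.
Proof. exact: (at_depth_inj (at_depth_depth r)). Qed.

Lemma depth_edge v w : E v w -> depth w = (depth v).+1.
Proof.
move=> vw; apply: (at_depth_inj (at_depth_depth w)) => /=; exists v => //.
exact: at_depth_depth.
Qed.

Lemma depth_eq0 v : depth v = 0%N -> v = r.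
Proof. by move=> v0; have := at_depth_depth v; rewrite v0. Qed.

Lemma depth_eqS v n : depth v = n.+1 -> exists2 u, E u v & depth u = n.
Proof.
move=> vn; have := at_depth_depth v; rewrite vn => -[u nu uv]; exists u => //.
exact: at_depth_inj (at_depth_depth u) nu.
Qed.

Lemma depth_path (w : nat -> N) n :
  infinite_path w -> depth (w n) = (depth (w 0%N) + n)%N.
Proof.
move=> wE; elim: n => [|n IH]; first by rewrite addn0.
by rewrite (depth_edge (wE n)) IH addnS.
Qed.

Lemma parent_edge v w : E v w -> parent w = v.
Proof.
have [_ uniq_parent _] := tree; move=> vw; rewrite /parent.
by case: xgetP => [u _ /= uw|/(_ v)//]; exact: uniq_parent uw vw.
Qed.

Lemma tree_rec_root X (x0 : X) g : tree_rec x0 g r = x0.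
Proof. by rewrite /tree_rec depth_root. Qed.

Lemma tree_rec_edge X (x0 : X) g v w : E v w ->
  tree_rec x0 g w = g v w (tree_rec x0 g v).
Proof. by move=> vw; rewrite /tree_rec (depth_edge vw) /= (parent_edge vw). Qed.

Lemma ancestor_edge v w n : E v w ->
  ancestor w n = if (n <= depth v)%N then ancestor v n else w.
Proof. by move=> vw; rewrite /ancestor (tree_rec_edge _ _ vw). Qed.

Lemma ancestor_id v n : (depth v <= n)%N -> ancestor v n = v.
Proof.
move: v; apply: tree_ind => [|v w vw _].
  by rewrite /ancestor tree_rec_root.
by rewrite (depth_edge vw) (ancestor_edge _ vw) ltnNge => /negbTE ->.
Qed.

Lemma depth_ancestor v n : (n <= depth v)%N -> depth (ancestor v n) = n.
Proof.
move: v; apply: tree_ind => [|v w vw IH].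
  by rewrite depth_root leqn0 => /eqP ->; rewrite ancestor_id ?depth_root.
rewrite (ancestor_edge _ vw); case: ifP => [/IH//|]; rewrite (depth_edge vw).
by move=> nv nv'; apply/eqP; rewrite eqn_leq nv' ltnNge nv.
Qed.

Lemma ancestor_step v n : (n < depth v)%N -> E (ancestor v n) (ancestor v n.+1).
Proof.
move: v; apply: tree_ind => [|v w vw IH]; first by rewrite depth_root.
rewrite (depth_edge vw) ltnS => nv; rewrite !(ancestor_edge _ vw) nv.
case: ifP => [/IH//|]; rewrite ltnNge => /negbFE vn.
by rewrite ancestor_id.
Qed.

Lemma ancestor_ancestor v n m : (m <= n)%N ->
  ancestor (ancestor v n) m = ancestor v m.
Proof.
move=> mn; move: v; apply: tree_ind => [|v w vw IH].
  by rewrite [ancestor r n]ancestor_id ?depth_root.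
rewrite (ancestor_edge n vw); case: ifP => // nv.
by rewrite (ancestor_edge m vw) (leq_trans mn nv) IH.
Qed.

Lemma hereditary_ancestor G v n : hereditary G -> G (ancestor v n) -> G v.
Proof.
move=> hG; move: v; apply: tree_ind => [|v w vw IH].
  by rewrite ancestor_id// depth_root.
by rewrite (ancestor_edge _ vw); case: ifP => // _ /IH; exact: hG.
Qed.

Section Koenig.
Variable G : set N.
Hypothesis finE : forall v, finite_set (E v).

Definition escapes_below v : Prop := forall n, exists v',
  [/\ clos_refl_trans N E v v', (n <= depth v')%N & ~ G v'].

Lemma escapes_below_child v :
  escapes_below v -> exists2 w, E v w & escapes_below w.
Proof.
move=> esc; apply: contrapT => noesc.
have /choice[bound boundP] w : exists n, E v w ->
    forall v', clos_refl_trans N E w v' -> (n <= depth v')%N -> G v'.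
  have [vw|nvw] := pselect (E v w); last by exists 0%N.
  have /existsNP[n nP] : ~ escapes_below w by move=> ew; apply: noesc; exists w.
  exists n => _ v' wv' nv'; apply: contrapT => Gv'.
  by apply: nP; exists v'.
have [v' [/clos_rt_rt1n_iff vv' + Gv']] :=
  esc (maxn (depth v).+1 (\max_(w <- fset_set (E v)) bound w)).
rewrite geq_max => /andP[vv'depth bv'].
case: vv' vv'depth bv' Gv' => [|w z vw /clos_rt_rt1n_iff wz _ bz Gz].
  by rewrite ltnn.
apply: Gz; apply: (boundP w) => //; apply: leq_trans bz.
by apply: (leq_bigmax_seq w); rewrite ?in_fset_set ?inE.
Qed.

Lemma koenig : hereditary G ->
  [set w | w 0%N = r /\ infinite_path w] `<=` hits G ->
  exists n, forall v, (n <= depth v)%N -> G v.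
Proof.
move=> hG cover; apply: contrapT => /forallNP noG.
have escr : escapes_below r.
  move=> n; have /existsNP[v /not_implyP[nv Gv]] := noG n.
  by exists v; split=> //; have [_ _] := tree.
have /choice[child childP] v :
    exists w, escapes_below v -> E v w /\ escapes_below w.
  have [/escapes_below_child[w vw ew]|nv] := pselect (escapes_below v).
    by exists w.
  by exists v.
have escw n : escapes_below (iter n child r) by elim: n => [//|n /childP[]].
have [n Gn] := cover (fun n => iter n child r)
  (conj erefl (fun n => (childP _ (escw n)).1)).
have [v' [/clos_rt_rt1n_iff reach _ +]] := escw n 0%N; apply.
by elim: reach Gn => // y z t yz _ IH Gy; exact: IH (hG _ _ yz Gy).
Qed.

End Koenig.
End RootedTrees.

(** * Trees with a probability flow *)

Record flow_tree (R : realType) (N : choiceType) (E : N -> N -> Prop) (r : N)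
    (p : N -> R) : Prop := FlowTree {
  flow_directed : directed_tree E r;
  flow_finite : forall v, finite_set (E v);
  flow_root : p r = 1;
  flow_gt0 : forall v, 0 < p v;
  flow_sum : forall v, ~ tip E v -> \sum_(w <- fset_set (E v)) p w = p v
}.

Section Mass.
Context {R : realType} {N : choiceType}.
Variables (E : N -> N -> Prop) (r : N) (p : N -> R).
Implicit Types (A B G : set N) (v : N) (n m k : nat).
Local Notation tip := (tip E).
Local Notation depth := (depth E r).
Local Notation ancestor := (ancestor E r).
Local Notation hereditary := (hereditary E).

Definition advance v : seq N := if `[< tip v >] then [:: v] else fset_set (E v).

(* The nodes at depth [n] together with the tips above them: the support of the
   law of a random path stopped at a tip, after [n] steps. *)
Fixpoint frontier n : seq N :=
  if n is m.+1 then [seq w | v <- frontier m, w <- advance v] else [:: r].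

Definition mass n A : R := \sum_(v <- frontier n | v \in A) p v.

Definition leaf_sum : \bar R := \esum_(v in tip) (p v)%:E.

Hypothesis ft : flow_tree E r p.
Let tree : directed_tree E r := flow_directed ft.

Lemma flow_ge0 v : 0 <= p v. Proof. exact: ltW (flow_gt0 ft v). Qed.

Lemma mem_advance v w : (w \in advance v) <-> (E v w \/ (tip v /\ w = v)).
Proof.
rewrite /advance; case: asboolP => [tv|ntv].
  by rewrite inE; split => [/eqP ->|[/tv//|[_ ->]]] //; right.
rewrite in_fset_set ?inE; last exact: flow_finite ft v.
by split=> [|[|[]]] //; left.
Qed.

Lemma sum_advance v : \sum_(w <- advance v) p w = p v.
Proof.
rewrite /advance; case: asboolP => [tv|ntv]; first by rewrite big_seq1.
exact: flow_sum ft v ntv.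
Qed.

Lemma mem_frontier n v :
  (v \in frontier n) <-> (depth v = n \/ (tip v /\ (depth v <= n)%N)).
Proof.
elim: n v => [|n IH] v /=.
  rewrite inE; split => [/eqP ->|]; first by left; rewrite (depth_root tree).
  case=> [/(depth_eq0 tree) ->//|[_]].
  by rewrite leqn0 => /eqP/(depth_eq0 tree) ->.
split=> [/allpairsPdep[u [w [/IH un /mem_advance uw ->]]]|].
  case: uw => [uw|[tu ->]].
    left; rewrite (depth_edge tree uw).
    by case: un => [->//|[/(_ _ uw)]].
  by right; split=> //; case: un => [->//|[_ /leqW]].
have via_parent : depth v = n.+1 -> v \in frontier n.+1.
  move=> /(depth_eqS tree)[u uv un]; apply/allpairsPdep; exists u, v.
  by split=> //; [apply/IH; left|apply/mem_advance; left].
case=> [/via_parent//|[tv]].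
rewrite leq_eqVlt => /predU1P[/via_parent//|dv].
apply/allpairsPdep; exists v, v.
by split=> //; [apply/IH; right|apply/mem_advance; right].
Qed.

Lemma frontier_depth n v : v \in frontier n -> (depth v <= n)%N.
Proof. by move=> /mem_frontier[->|[]]. Qed.

Lemma uniq_frontier n : uniq (frontier n).
Proof.
elim: n => [//|n IH] /=; apply: allpairs_uniq_dep => //.
  by move=> v _; rewrite /advance; case: ifP => // _; exact: fset_uniq.
have no_tip_child u v :
    u \in frontier n -> tip u -> v \in frontier n -> ~ E v u.
  move=> /frontier_depth un tu /mem_frontier vn vu.
  move: un; rewrite (depth_edge tree vu).
  by case: vn => [->|[/(_ _ vu)//]]; rewrite ltnn.
have [_ uniq_parent _] := tree.
move=> x y /allpairsPdep[u [w [un /mem_advance uw ->]]].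
move=> /allpairsPdep[v [z [vn /mem_advance vz ->]]] /= wz.
move: vz; rewrite -wz => vw; suff -> : u = v by [].
case: uw vw => [uw|[tu wu]] [vw|[tv wv]].
- exact: uniq_parent uw vw.
- by move: uw; rewrite wv => /no_tip_child; case.
- by move: vw; rewrite wu => /no_tip_child; case.
- by rewrite -wu.
Qed.

Lemma mass_ge0 n A : 0 <= mass n A.
Proof. by apply: sumr_ge0 => v _; exact: flow_ge0. Qed.

Lemma le_mass n A B : (forall v, v \in frontier n -> A v -> B v) ->
  mass n A <= mass n B.
Proof.
move=> AB; rewrite /mass big_mkcond [leRHS]big_mkcond /=.
apply: ler_sum_seq => v vn; case: ifP => [/set_mem/(AB _ vn)/mem_set ->//|_].
by case: ifP => // _; exact: flow_ge0.
Qed.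

Lemma mass_set0 n : mass n set0 = 0.
Proof. by rewrite /mass big_pred0// => v; rewrite in_set0. Qed.

Lemma mass_setT n : mass n [set: N] = 1.
Proof.
rewrite /mass (eq_bigl xpredT); last by move=> v; rewrite in_setT.
elim: n => [|n IH] /=; first by rewrite big_seq1 (flow_root ft).
by rewrite big_allpairs_dep -[RHS]IH; apply: eq_bigr => v _; exact: sum_advance.
Qed.

Lemma massID n A B : mass n A = mass n (A `&` B) + mass n (A `\` B).
Proof.
rewrite /mass (bigID (mem B)) /=; congr (_ + _); apply: eq_bigl => v.
  by rewrite in_setI.
by rewrite in_setD.
Qed.

Lemma mass_setC n A : mass n (~` A) = 1 - mass n A.
Proof. by rewrite -(mass_setT n) (massID n setT A) setTI setTD addrC addKr. Qed.

Lemma mass_le1 n A : mass n A <= 1.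
Proof. by rewrite -subr_ge0 -mass_setC mass_ge0. Qed.

Lemma mass_setU n A B : mass n (A `|` B) <= mass n A + mass n B.
Proof.
by rewrite (massID n _ A) setUK; apply: lerD => //; apply: le_mass => v _ [[]].
Qed.

Lemma mass_bigcup n k (A : nat -> set N) :
  mass n (\bigcup_(i < k) A i) <= \sum_(i < k) mass n (A i).
Proof.
elim: k => [|k IH].
  by rewrite big_ord0 -(mass_set0 n); apply: le_mass => v _ [].
rewrite big_ord_recr /=; apply: le_trans (lerD IH (lexx _)).
apply: le_trans (mass_setU _ _ _); apply: le_mass => v _ [i /= + Aiv].
by rewrite ltnS leq_eqVlt => /predU1P[<-|ik]; [right|left; exists i].
Qed.

Lemma le_mass_succ n A B :
  (forall v w, v \in frontier n -> A v -> E v w -> B w) ->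
  (forall v, v \in frontier n -> A v -> tip v -> B v) ->
  mass n A <= mass n.+1 B.
Proof.
move=> ABE ABtip.
rewrite /mass big_mkcond [leRHS]big_mkcond /= big_allpairs_dep.
apply: ler_sum_seq => v vn; case: ifP => [/set_mem Av|_]; last first.
  by apply: sumr_ge0 => w _; case: ifP => // _; exact: flow_ge0.
rewrite -(sum_advance v); apply: ler_sum_seq => w /mem_advance vw.
rewrite mem_set//; case: vw => [|[tv ->]]; [exact: ABE|exact: ABtip].
Qed.

Lemma mass_nondecreasing n m G :
  hereditary G -> (n <= m)%N -> mass n G <= mass m G.
Proof.
move=> hG; apply: (homo_leq (f := mass ^~ G) lexx le_trans) => i.
by apply: le_mass_succ => // v w _ Gv vw; exact: hG Gv.
Qed.

Lemma flow_le1 v : p v <= 1.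
Proof.
rewrite -(big_seq1 +%R v p) -(mass_setT (depth v)) /mass.
rewrite [leRHS](eq_bigl xpredT); last by move=> w; rewrite in_setT.
apply: ler_sum_uniq_subset => //; last exact: flow_ge0.
by move=> w; rewrite inE => /eqP ->; apply/mem_frontier; left.
Qed.

Lemma mass_ancestor n m A : (n <= m)%N ->
  mass m [set v | A (ancestor v n)] = mass n A.
Proof.
move=> nm.
have mass_le B : mass n B <= mass m [set v | B (ancestor v n)].
  elim: m nm => [|m IH].
    rewrite leqn0 => /eqP ->; apply: le_mass => v /frontier_depth dv /=.
    by rewrite (ancestor_id tree).
  rewrite leq_eqVlt => /predU1P[->|nm].
    by apply: le_mass => v /frontier_depth dv /=; rewrite (ancestor_id tree).
  apply: le_trans (IH nm) _.
  apply: le_mass_succ => // v w /mem_frontier vm Bv vw.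
  case: vm => [dv|[/(_ _ vw)//]].
  by rewrite /= (ancestor_edge tree _ vw) dv -ltnS nm.
apply/eqP; rewrite eq_le mass_le andbT.
by rewrite -[leRHS]opprK lerNr -(lerD2l 1) -!mass_setC; exact: (mass_le (~` A)).
Qed.

Lemma mass_near_sup G k (eps : R) : hereditary G -> 0 < eps ->
  exists n, (k <= n)%N /\ forall m, mass m G <= mass n G + eps.
Proof.
move=> hG eps0.
have Gsup : has_sup (range (mass ^~ G)).
  split; first by exists (mass 0 G), 0%N.
  by exists 1 => _ [m _ <-]; exact: mass_le1.
have [_ [n _ <-] nG] := sup_adherent eps0 Gsup.
exists (maxn k n); split=> [|m]; first exact: leq_maxl.
have mG : mass m G <= sup (range (mass ^~ G)).
  by apply: ub_le_sup; [case: Gsup|exists m].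
have := mass_nondecreasing hG (leq_maxr k n); lra.
Qed.

Lemma sum_tips_le (X : {fset N}) : (forall v, v \in X -> tip v) ->
  exists n, \sum_(v <- X) p v <= mass n tip.
Proof.
move=> Xtip; exists (\max_(v <- X) depth v)%N.
rewrite /mass -[leRHS]big_filter; apply: ler_sum_uniq_subset.
- exact: fset_uniq.
- move=> v vX; rewrite mem_filter mem_set /=; last exact: Xtip.
  apply/mem_frontier; right; split; first exact: Xtip.
  exact: leq_bigmax_seq.
- exact: flow_ge0.
Qed.

Lemma fsets_tip (X : set N) : fsets tip X ->
  (\sum_(v \in X) (p v)%:E)%E = (\sum_(v <- fset_set X) p v)%:E /\
  (forall v, v \in fset_set X -> tip v).
Proof.
move=> [finX Xtip]; rewrite fsbig_finite//= sumEFin; split=> // v.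
by rewrite in_fset_set// inE => /Xtip.
Qed.

Lemma leaf_sum_le1 : (leaf_sum <= 1)%E.
Proof.
apply: ge_ereal_sup => _ [X /fsets_tip[-> Xtip] <-]; rewrite lee_fin.
by have [n /le_trans] := sum_tips_le Xtip; apply; exact: mass_le1.
Qed.

Lemma mass_tip_le_leaf_sum n : ((mass n tip)%:E <= leaf_sum)%E.
Proof.
apply: esum_ge; exists [set` [seq v <- frontier n | v \in tip]].
  split=> [|v /=]; first exact: finite_seq.
  by rewrite mem_filter => /andP[/set_mem].
rewrite fsbig_finite ?finite_seq//= sumEFin lee_fin /mass -[leLHS]big_filter.
apply: ler_sum_uniq_subset; last exact: flow_ge0.
  by rewrite filter_uniq// uniq_frontier.
by move=> v vf; rewrite in_fset_set ?finite_seq// inE.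
Qed.

Lemma leaf_sum1P :
  leaf_sum = 1%E <-> forall eps, 0 < eps -> exists n, mass n (~` tip) <= eps.
Proof.
split=> [sum1 eps eps0|small].
  have : ((1 - eps)%:E < leaf_sum)%E by rewrite sum1 lte_fin ltrBlDr ltrDl.
  move=> /ereal_sup_gt[_ [X /fsets_tip[-> Xtip] <-]]; rewrite lte_fin => Xeps.
  have [n Xn] := sum_tips_le Xtip; exists n.
  by rewrite mass_setC; move: Xeps Xn; lra.
apply/eqP; rewrite eq_le leaf_sum_le1 /=.
apply/lee_addgt0Pr => eps /small[n nP].
apply: (@le_trans _ _ ((mass n tip)%:E + eps%:E)%E).
  by rewrite -EFinD lee_fin; move: nP; rewrite mass_setC; lra.
by apply: leeD2r; exact: mass_tip_le_leaf_sum.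
Qed.

Definition null (A : set (nat -> N)) : Prop := forall eps, 0 < eps ->
  exists G, [/\ hereditary G, forall n, mass n G <= eps & A `<=` hits G].

Lemma sub_null (A B : set (nat -> N)) : A `<=` B -> null B -> null A.
Proof.
move=> AB nB eps /nB[G [hG Geps BG]]; exists G; split=> //.
exact: subset_trans BG.
Qed.

Lemma null_set0 : null set0.
Proof.
move=> eps eps0; exists set0; split=> [//|n|//].
by rewrite mass_set0 ltW.
Qed.

Lemma null_bigcup_nat (A : nat -> set (nat -> N)) :
  (forall i, null (A i)) -> null (\bigcup_i A i).
Proof.
move=> nA eps eps0.
have /choice[G GP] i : exists G,
    [/\ hereditary G, forall n, mass n G <= eps / 2 ^+ i.+1 & A i `<=` hits G].
  by apply: nA; rewrite divr_gt0// exprn_gt0.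
exists (\bigcup_i G i); split.
- move=> v w vw [i _ Giv]; exists i => //.
  by have [hG _ _] := GP i; exact: hG Giv.
- move=> n; have /choice[f fP] v : exists i, (\bigcup_i G i) v -> G i v.
    by have [[i _ Gi]|nG] := pselect ((\bigcup_i G i) v); [exists i|exists 0%N].
  pose k := (\max_(v <- frontier n) f v).+1.
  apply: (@le_trans _ _ (mass n (\bigcup_(i < k) G i))).
    apply: le_mass => v vn /fP Gv; exists (f v) => //=.
    by rewrite ltnS; exact: leq_bigmax_seq.
  apply: le_trans (mass_bigcup _ _ _) _.
  apply: le_trans (ltW (sum_half_powers_lt k eps0)).
  by apply: ler_sum => i _; have [_ -> _] := GP i.
- move=> w [i _ Aw]; have [_ _ /(_ _ Aw)[n Gn]] := GP i; exists n.
  by exists i.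
Qed.

Lemma null_bigcup (I : Type) (D : set I) (A : I -> set (nat -> N)) :
  countable D -> (forall i, D i -> null (A i)) -> null (\bigcup_(i in D) A i).
Proof.
move=> /countable_injP[f finj] nA.
apply: (@sub_null _ (\bigcup_n \bigcup_(i in D `&` f @^-1` [set n]) A i)).
  by move=> w [i Di Aw]; exists (f i) => //; exists i.
apply: null_bigcup_nat => n.
have [[i [Di fi]]|none] := pselect (exists i, D i /\ f i = n); last first.
  by apply: sub_null null_set0 => w [i [Di fi] _]; apply: none; exists i.
apply: sub_null (nA i Di) => w [j [Dj fj]].
by rewrite (finj j i) ?inE// fi.
Qed.

Lemma null_infinite_path_leaf_sum1 :
  null [set w | w 0%N = r /\ infinite_path E w] -> leaf_sum = 1%E.
Proof.
move=> nA; apply/leaf_sum1P => eps /nA[G [hG Geps cover]].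
have [n nG] := koenig tree (flow_finite ft) hG cover.
exists n; apply: le_trans (Geps n); apply: le_mass => v /mem_frontier vn ntv.
by apply: nG; case: vn => [->//|[]].
Qed.

Lemma countable_nodes : countable [set: N].
Proof.
rewrite (_ : setT = \bigcup_n [set` frontier n]).
  by apply: bigcup_countable => // n _; apply/finite_set_countable/finite_seq.
apply/seteqP; split=> // v _; exists (depth v) => //=.
by apply/mem_frontier; left.
Qed.

End Mass.

(** * Pruned trees *)

Section Pruning.
Context {R : realType} {N : choiceType}.
Variables (E : N -> N -> Prop) (r : N) (p : N -> R).
Variables (u : N) (cut : set N).
Implicit Types (v w : N).

Definition uncut_edge v w : Prop := E v w /\ ~ cut v.

Definition kept : set N := [set v | clos_refl_trans N uncut_edge u v].

(* The tree of the nodes reached from [u] without passing below a node of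
   [cut], with the probabilities conditioned on reaching [u]. *)
Definition pruned : choiceType := {v : N | `[< kept v >]}.
Implicit Types a b : pruned.

Definition pruned_edge a b : Prop := uncut_edge (val a) (val b).
Definition pruned_prob a : R := p (val a) / p u.
Definition pruned_node v (kv : kept v) : pruned := exist _ v (asboolT kv).
Definition pruned_root : pruned := pruned_node (rt_refl N uncut_edge u).

Lemma kept_val a : kept (val a). Proof. exact: asboolW (valP a). Qed.

Lemma kept_edge v w : kept v -> uncut_edge v w -> kept w.
Proof. by move=> kv vw; apply: rt_trans kv _; exact: rt_step. Qed.

Lemma kept_path (w : nat -> N) :
  w 0%N = u -> infinite_path uncut_edge w -> forall n, kept (w n).
Proof.
move=> w0 wE; elim=> [|n IH]; first by rewrite w0; exact: rt_refl.
exact: kept_edge IH (wE n).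
Qed.

Lemma tip_pruned a : tip pruned_edge a <-> (tip E (val a) \/ cut (val a)).
Proof.
split=> [ta|[ta|ca] b []]; [|by move=> /ta|by []].
have [ca|nca] := pselect (cut (val a)); [by right|left] => w aw.
have kw : kept w by apply: kept_edge (kept_val a) _.
exact: (ta (pruned_node kw)).
Qed.

Hypothesis ft : flow_tree E r p.
Let tree : directed_tree E r := flow_directed ft.

Lemma kept_depth v : kept v -> (depth E r u <= depth E r v)%N.
Proof.
move/clos_rt_rtn1_iff; elim=> // y z [yz _] _ /leq_trans; apply.
by rewrite (depth_edge tree yz).
Qed.

Lemma directed_tree_pruned : directed_tree pruned_edge pruned_root.
Proof.
have [_ uniq_parent _] := tree; split.
- move=> a [au _]; have := kept_depth (kept_val a).
  by rewrite (depth_edge tree au) /= ltnn.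
- by move=> a b c [ac _] [bc _]; apply: val_inj; exact: uniq_parent ac bc.
- move=> a; have /clos_rt_rtn1_iff := kept_val a.
  move va: (val a) => v kv; elim: kv a va => [a va|y z yz ky IH a va].
    by rewrite (_ : a = pruned_root); [exact: rt_refl|exact: val_inj].
  have {}ky : kept y by apply/clos_rt_rtn1_iff.
  apply: rt_trans (IH (pruned_node ky) erefl) _; apply: rt_step.
  by rewrite /pruned_edge va.
Qed.

Lemma finite_pruned_edge a : finite_set (pruned_edge a).
Proof.
apply: (@sub_finite_set _ _ (val @^-1` E (val a))); first by move=> b [].
by apply: finite_preimage (flow_finite ft _) => b c _ _; exact: val_inj.
Qed.

Lemma perm_pruned_edge a : ~ cut (val a) ->
  perm_eq [seq val b | b <- fset_set (pruned_edge a)] (fset_set (E (val a))).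
Proof.
move=> nca; have fina := finite_pruned_edge a.
have finE := flow_finite ft (val a).
apply: uniq_perm; [|exact: fset_uniq|].
  by rewrite map_inj_uniq; [exact: fset_uniq|exact: val_inj].
move=> w; rewrite in_fset_set//; apply/mapP/idP => [[b + ->]|].
  by rewrite in_fset_set// !inE => -[].
rewrite inE => aw; have kw : kept w by apply: kept_edge (kept_val a) _.
by exists (pruned_node kw) => //; rewrite in_fset_set ?inE.
Qed.

Lemma flow_tree_pruned : flow_tree pruned_edge pruned_root pruned_prob.
Proof.
split.
- exact: directed_tree_pruned.
- exact: finite_pruned_edge.
- by rewrite /pruned_prob /= divff// gt_eqF// (flow_gt0 ft).
- by move=> a; rewrite divr_gt0// (flow_gt0 ft).
move=> a; rewrite tip_pruned => /not_orP[nta nca].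
rewrite /pruned_prob -mulr_suml -(big_map val xpredT p).
by rewrite (perm_big _ (perm_pruned_edge nca)) (flow_sum ft).
Qed.

Lemma depth_pruned a :
  depth E r (val a) = (depth E r u + depth pruned_edge pruned_root a)%N.
Proof.
have ptree := directed_tree_pruned.
move: a; apply: (tree_ind ptree) => [|a b ab IH].
  by rewrite (depth_root ptree) addn0.
by rewrite (depth_edge ptree ab) addnS -IH (depth_edge tree ab.1).
Qed.

Lemma mass_pruned n (A : set N) :
  mass E r p (depth E r u + n) (kept `&` A) <=
  p u * mass pruned_edge pruned_root pruned_prob n (val @^-1` A).
Proof.
have pu : p u != 0 by rewrite gt_eqF// (flow_gt0 ft).
rewrite /mass /pruned_prob -mulr_suml mulrCA divff// mulr1 -[leLHS]big_filter.
rewrite -[leRHS]big_filter -(big_map val xpredT p).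
apply: ler_sum_uniq_subset; last exact: flow_ge0 ft.
  by rewrite filter_uniq//; exact: uniq_frontier ft _.
move=> v; rewrite mem_filter => /andP[/set_mem[kv Av]] /(mem_frontier ft) vn.
apply/mapP; exists (pruned_node kv) => //; rewrite mem_filter mem_set//=.
apply/(mem_frontier flow_tree_pruned).
have := depth_pruned (pruned_node kv) => /= dv.
case: vn => [|[tv]]; rewrite dv; first by move=> /addnI ->; left.
by rewrite leq_add2l => kn; right; split=> //; apply/tip_pruned; left.
Qed.

End Pruning.
Arguments pruned_edge {N} E u cut a b.
Arguments pruned_prob {R N} E p u cut a.

(** * Infinitely many visits *)

Section Visits.
Context {R : realType} {N : choiceType}.
Variables (E : N -> N -> Prop) (r : N) (p : N -> R) (D : set N).
Local Notation depth := (depth E r).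
Local Notation ancestor := (ancestor E r).
Local Notation mass := (mass E r p).

(* The number of nodes of [D] strictly above [v]. *)
Definition visits : N -> nat :=
  tree_rec E r 0%N (fun v _ k => (k + `[< D v >])%N).

Definition visited k : set N := [set v | (k <= visits v)%N].

Hypothesis ft : flow_tree E r p.
Let tree : directed_tree E r := flow_directed ft.

Lemma visits_edge v w : E v w -> visits w = (visits v + `[< D v >])%N.
Proof. by move=> vw; rewrite /visits (tree_rec_edge tree _ _ vw). Qed.

Lemma visits_le_depth v : (visits v <= depth v)%N.
Proof.
move: v; apply: (tree_ind tree) => [|v w vw IH].
  by rewrite /visits (tree_rec_root tree).
rewrite (visits_edge vw) (depth_edge tree vw) -addn1.
by apply: leq_add => //; case: asboolP.
Qed.

Lemma hereditary_visited k : hereditary E (visited k).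
Proof.
by move=> v w vw /leq_trans; apply; rewrite (visits_edge vw) leq_addr.
Qed.

Lemma path_visits_nondecreasing (w : nat -> N) n m : infinite_path E w ->
  (n <= m)%N -> (visits (w n) <= visits (w m))%N.
Proof.
move=> wE; apply: (homo_leq (f := visits \o w) leqnn leq_trans) => i /=.
by rewrite (visits_edge (wE i)) leq_addr.
Qed.

Lemma infinitely_often_hits_visited k :
  infinite_path E `&` infinitely_often D `<=` hits (visited k).
Proof.
move=> w [wE wD]; elim: k => [|k [n kn]]; first by exists 0%N.
have [m nm Dm] := wD n; exists m.+1.
rewrite /visited /= (visits_edge (wE m)) asboolT//= addn1 ltnS.
exact: leq_trans kn (path_visits_nondecreasing wE nm).
Qed.

Lemma kept_uncut (cut : set N) v :
  (forall j, (j < depth v)%N -> ~ cut (ancestor v j)) -> kept E r cut v.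
Proof.
move: v; apply: (tree_ind tree) => [_|v w vw IH uncut]; first exact: rt_refl.
apply: kept_edge (IH _) _ => [j jv|].
  have := uncut j; rewrite (depth_edge tree vw) (ancestor_edge tree _ vw).
  by rewrite (ltnW jv); apply; exact: ltnW.
split=> //; have := uncut (depth v); rewrite (depth_edge tree vw).
rewrite (ancestor_edge tree _ vw) !leqnn (ancestor_id tree)//.
by move=> /(_ isT).
Qed.

Section Behind.
Variables (sched : nat -> nat) (slack : nat -> R).
Hypothesis le_sched : forall i, (i <= sched i)%N.
Hypothesis sched_slack : forall i m,
  mass m (visited i) <= mass (sched i) (visited i) + slack i.

Definition behind : set N :=
  [set v | exists2 i, depth v = sched i & (visits v < i)%N].

Definition live : set N := kept E r behind `\` (tip E `|` behind).

Definition late i : set N :=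
  visited i `\` [set v | visited i (ancestor v (sched i))].

Lemma uncut_behind_infinitely_often :
  infinite_path (uncut_edge E behind) `<=` infinitely_often D.
Proof.
move=> w wE n; apply: contrapT => noD.
have wE' : infinite_path E w by move=> m; case: (wE m).
have visits_const m : (n <= m)%N -> visits (w m) = visits (w n).
  elim: m => [|m IH]; first by rewrite leqn0 => /eqP ->.
  rewrite leq_eqVlt => /predU1P[->//|nm].
  rewrite (visits_edge (wE' m)) IH// asboolF ?addn0// => Dm.
  by apply: noD; exists m.
have [i iE] : exists i, i = (visits (w n) + depth (w n)).+1 by eexists.
have i_sched := le_sched i; have dn := depth_path tree n wE'.
have [_] := wE (sched i - depth (w 0%N))%N; apply; exists i.
  by rewrite (depth_path tree _ wE') subnKC//; lia.
by rewrite visits_const; lia.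
Qed.

Lemma mass_late i m : (sched i <= m)%N -> mass m (late i) <= slack i.
Proof.
move=> sched_m.
have := massID E r p m (visited i) [set v | visited i (ancestor v (sched i))].
have -> : visited i `&` [set v | visited i (ancestor v (sched i))] =
    [set v | visited i (ancestor v (sched i))].
  apply/seteqP; split=> [v []//|v vi]; split=> //.
  exact: (hereditary_ancestor tree (hereditary_visited (k := i))) vi.
by rewrite (mass_ancestor ft)// /late; have := sched_slack i m; lra.
Qed.

Lemma visited_live_or_late n :
  visited n.+1 `<=` [set v | live (ancestor v n)] `|` \bigcup_(i < n.+1) late i.
Proof.
move=> v nv; have nd : (n < depth v)%N := leq_trans nv (visits_le_depth v).
have depth_anc j : (j <= n)%N -> depth (ancestor v j) = j.
  by move=> jn; rewrite (depth_ancestor tree)// (leq_trans jn)// ltnW.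
have [[j jn [i]]|uncut] :=
    pselect (exists2 j, (j <= n)%N & behind (ancestor v j)).
  rewrite depth_anc// => ji vi; right.
  have iln : (i <= n)%N by rewrite (leq_trans (le_sched i))// -ji.
  exists i => //; split; first by rewrite /visited /= (leq_trans _ nv)// leqW.
  by rewrite /visited /= -ji; apply/negP; rewrite -ltnNge.
left; split=> [|[/(_ (ancestor v n.+1))|cut_n]].
- apply: kept_uncut => j; rewrite depth_anc// => jn.
  have -> : ancestor (ancestor v n) j = ancestor v j.
    by rewrite (ancestor_ancestor tree)// ltnW.
  by move=> cut_j; apply: uncut; exists j => //; exact: ltnW.
- by apply; exact: ancestor_step.
- by apply: uncut; exists n.
Qed.

Lemma mass_visited n m :
  mass m (visited n.+1) <= mass n live + \sum_(i < n.+1) slack i.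
Proof.
pose k := maxn m (maxn n (\max_(i < n.+1) sched i)).
have sched_k (i : 'I_n.+1) : (sched i <= k)%N.
  by rewrite !leq_max leq_bigmax !orbT.
apply: (@le_trans _ _ (mass k (visited n.+1))).
  by apply: (mass_nondecreasing ft _ (leq_maxl _ _)); exact: hereditary_visited.
apply: le_trans (le_mass ft (fun v _ => @visited_live_or_late n v)) _.
apply: le_trans (mass_setU ft _ _ _) (lerD _ _).
  by rewrite (mass_ancestor ft) // !leq_max leqnn orbT.
apply: le_trans (mass_bigcup ft _ _ _) (ler_sum _ _) => i _.
exact: mass_late.
Qed.

End Behind.

Lemma mass_live sched :
  leaf_sum (pruned_edge E r (behind sched))
    (pruned_prob E p r (behind sched)) = 1%E ->
  forall eps, 0 < eps -> exists n, mass n (live sched) <= eps.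
Proof.
have pft := flow_tree_pruned r (behind sched) ft.
move=> /(leaf_sum1P pft) small eps /small[n nP]; exists n.
have := mass_pruned r (behind sched) ft n (~` (tip E `|` behind sched)).
rewrite (depth_root tree) add0n (flow_root ft) mul1r => /le_trans; apply.
apply: le_trans nP; apply: (le_mass pft) => a _ + /tip_pruned ta.
by apply.
Qed.

(* If the paths visiting [D] infinitely often were not negligible, then cutting
   at depth [sched i] the nodes that have not yet visited [D] at least [i] times
   would lose little of their mass, by the choice of [sched], and leave a tree
   each of whose infinite paths visits [D] infinitely often. *)
Lemma null_infinitely_often :
  (forall cut : set N,
    infinite_path (uncut_edge E cut) `<=` infinitely_often D ->
    leaf_sum (pruned_edge E r cut) (pruned_prob E p r cut) = 1%E) ->
  null E r p (infinite_path E `&` infinitely_often D).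
Proof.
move=> pruned_sum1 eps eps0.
have eps2 : 0 < eps / 2 by rewrite divr_gt0.
have /choice[sched schedP] i : exists n, (i <= n)%N /\ forall m,
    mass m (visited i) <= mass n (visited i) + eps / 2 / 2 ^+ i.+1.
  apply: (mass_near_sup ft); first exact: hereditary_visited.
  by rewrite divr_gt0// exprn_gt0.
have le_sched i := (schedP i).1; have sched_slack i := (schedP i).2.
have [n nlive] := mass_live
  (pruned_sum1 _ (uncut_behind_infinitely_often le_sched)) eps2.
exists (visited n.+1); split=> [|m|].
- exact: hereditary_visited.
- have := mass_visited le_sched sched_slack n m.
  by have := sum_half_powers_lt n.+1 eps2; lra.
- exact: infinitely_often_hits_visited.
Qed.

End Visits.

Section NullSubtree.
Context {R : realType} {N : choiceType}.
Variables (E : N -> N -> Prop) (r : N) (p : N -> R) (u : N).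
Hypothesis ft : flow_tree E r p.
Local Notation subtree := (pruned E u set0).
Local Notation subtree_edge := (pruned_edge E u set0).
Local Notation subtree_root := (pruned_root E u set0).

Lemma null_subtree (A : set (nat -> subtree)) :
  null subtree_edge subtree_root (pruned_prob E p u set0) A ->
  null E r p [set w | exists K, exists2 w', A w' &
    forall n, w (K + n)%N = val (w' n)].
Proof.
have sft := flow_tree_pruned u set0 ft.
move=> nA eps /nA[G [hG Geps cover]].
have hvalG : hereditary E (val @` G).
  move=> v w vw [a Ga av]; have aw : uncut_edge E set0 (val a) w.
    by rewrite av; split=> // -[].
  exists (pruned_node (kept_edge (kept_val a) aw)) => //.
  exact: hG Ga.
exists (val @` G); split=> // [n|w].
- apply: le_trans (mass_nondecreasing ft hvalG (leq_addl (depth E r u) n)) _.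
  apply: (@le_trans _ _ (mass E r p (depth E r u + n)
      (kept E u set0 `&` (val @` G)))).
    by apply: (le_mass ft) => _ _ [a Ga <-]; split; [exact: kept_val|exists a].
  apply: le_trans (mass_pruned u set0 ft n _) _.
  apply: (@le_trans _ _ (1 * mass subtree_edge subtree_root
      (pruned_prob E p u set0) n G)); last by rewrite mul1r.
  apply: ler_pM (flow_ge0 ft u) (mass_ge0 sft _ _) (flow_le1 ft u) _.
  by apply: (le_mass sft) => a _ [b Gb /val_inj <-].
- move=> [K [w' /cover[n Gn] ww']]; exists (K + n)%N; rewrite ww'.
  by exists (w' n).
Qed.

End NullSubtree.

(** * Chain trees as derivations *)

Section Problems.
Context {R : realType} {Sg : signature} {V : Type}.
Variable P : set (adp R Sg V).
Hypothesis hP : adp_problem P.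

Lemma problem_lhs_root a :
  P a -> exists f : defs Sg, root_sym (lhs a) = Some (inl f).
Proof. by move=> /hP.2[]. Qed.

Lemma problem_multi_distribution a : P a -> multi_distribution (rhs a).
Proof. by move=> /hP.2[]. Qed.

Lemma reducesP s d : reduces P s d <->
  [/\ P (rule d), subterm_at (flat s) (position d) = Some (redex_term d)
    & ANF P (emb (redex_term d))].
Proof.
rewrite subterm_at_flat; split.
  by case=> Pd _ [u -> /= fu] anf; split=> //; rewrite fu.
case su: (subterm_at s (position d)) => [u|] [Pd] // [fu] anf.
split=> //; last by exists u.
have [f] := problem_lhs_root Pd; rewrite /pos_def /sym_at /= su /=.
move: fu; rewrite /redex_term; case: (lhs _) => //= g a + [gf].
rewrite {}gf in a *.
case: u {su} => //= -[g' b|f' b] /(congr1 root_sym) /= [] ->; exists f.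
  by left.
by right.
Qed.

End Problems.

Section Derivations.
Context {R : realType} {Sg : signature} {V : Type} {N : choiceType}.
Implicit Types (P : set (adp R Sg V)) (E : N -> N -> Prop) (p : N -> R).
Implicit Types (t : N -> aterm Sg V) (v : N).

(* [pick] matches each child with the element of the right-hand side that
   produced its label. *)
Record move := Move {
  move_reduction :> reduction R Sg V;
  pick : N -> R * aterm Sg V
}.

Definition valid_move P E p t v (m : move) : Prop :=
  [/\ reduces P (t v) m,
      perm_eq [seq pick m w | w <- fset_set (E v)] (rhs (rule m)),
      forall w, E v w -> p w = p v * (pick m w).1
    & forall w, E v w -> t w = reduct (t v) m (pick m w).2].

Definition derivation P E p t (m : N -> move) : Prop :=
  forall v, ~ tip E v -> valid_move P E p t v (m v).

Definition consuming t (m : N -> move) : set N :=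
  [set v | consumes (t v) (m v)].

Lemma valid_moveP P (T : labelled_tree R Sg V N) v b :
  finite_set (children T v) -> 0 < prob T v ->
  (exists2 c, consuming_case c = b &
    adp_step P (label T v) c (child_distr T v)) <->
  (exists2 m : move, valid_move P (edge T) (prob T) (label T) v m &
    consumes (label T v) m = b).
Proof.
move=> fin pv.
have in_children w : w \in fset_set (children T v) <-> edge T v w.
  by rewrite in_fset_set// inE.
split=> [/adp_stepP[d [red db /esym/eq_seq_msetP]]|[m [red perm pE tE] mb]].
  rewrite perm_sym.
  move=> /(perm_map_factor (0, label T v) (fset_uniq _))[f perm fE].
  exists (Move d f) => //; split=> // w /in_children/fE[pE tE] //.
  by rewrite -pE mulrC divfK ?gt_eqF.
apply/adp_stepP; exists m; split=> //; apply/eq_seq_msetP.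
rewrite -(permPr (perm_map _ perm)) -map_comp.
have /eq_in_map -> // : {in fset_set (children T v),
    (fun w => (prob T w / prob T v, label T w)) =1
    (fun y => (y.1, reduct (label T v) m y.2)) \o pick m}.
by move=> w /in_children vw /=; rewrite pE// tE// mulrAC divff ?mul1r ?gt_eqF.
Qed.

Lemma valid_move_sum P E p t v (m : move) : finite_set (E v) ->
  multi_distribution (rhs (rule m)) -> valid_move P E p t v m ->
  \sum_(w <- fset_set (E v)) p w = p v.
Proof.
move=> fin [_ sum1] [_ perm pE _].
rewrite (eq_big_seq (fun w => p v * (pick m w).1)); last first.
  by move=> w; rewrite in_fset_set// inE => /pE.
rewrite -mulr_sumr -(big_map (pick m) xpredT fst) (perm_big _ perm).
by rewrite sum1 mulr1.
Qed.

Lemma leafE (T : labelled_tree R Sg V N) : leaf T = tip (edge T).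
Proof.
apply/seteqP; split=> v => [lv w vw|tv].
  by have : children T v w by []; rewrite lv.
by apply/seteqP; split=> // w /tv.
Qed.

Lemma chain_tree_derivation P (T : labelled_tree R Sg V N) :
  adp_problem P -> chain_tree P T -> exists r m,
  [/\ flow_tree (edge T) r (prob T), derivation P (edge T) (prob T) (label T) m
    & infinite_path (edge T) `<=` infinitely_often (consuming (label T) m)].
Proof.
move=> hP [[r tree pr] [fin pos _ [stepP stepR] inf]].
have p_gt0 v : 0 < prob T v by case/andP: (pos v).
have /choice[m mP] v : exists m : move, ~ tip (edge T) v ->
    valid_move P (edge T) (prob T) (label T) v m /\
    consumes (label T v) m = `[< nodesP T v >].
  have [tv|] := pselect (tip (edge T) v).
    by exists (Move (Reduction (ADP (flat (label T v)) (seq_mset [::]) true) Var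
      [::]) (fun=> (0, label T v))).
  rewrite -leafE => ntv.
  have /(valid_moveP P _ (fin v) (p_gt0 v))[m] : exists2 c,
      consuming_case c = `[< nodesP T v >] &
      adp_step P (label T v) c (child_distr T v).
    case: asboolP => [vP|nvP].
      by case: (stepP v vP) => st; [exists case_pr|exists case_p].
    by case: (stepR v ntv nvP) => st; [exists case_r|exists case_irr].
  by exists m.
have drv : derivation P (edge T) (prob T) (label T) m by move=> v /mP[].
exists r, m; split=> // [|w wE n].
  split=> // v ntv; have mv := drv v ntv.
  apply: (valid_move_sum (fin v) _ mv).
  by apply: (problem_multi_distribution hP); case: mv => -[].
have [k nk kP] := inf w wE n; exists k => //.
rewrite /consuming /= (mP (w k) _).2; first exact/asboolP.
exact: not_tip (wE k).
Qed.

Lemma derivation_chain_tree P E r p t m :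
  flow_tree E r p -> derivation P E p t m ->
  infinite_path E `<=` infinitely_often (consuming t m) ->
  chain_tree P (LabelledTree E p t (~` tip E `&` consuming t m)).
Proof.
move=> ft drv inf; set T := LabelledTree _ _ _ _.
have fin v : finite_set (children T v) by exact: flow_finite ft v.
have step v : ~ tip E v -> exists2 c, consuming_case c = consumes (t v) (m v) &
    adp_step P (t v) c (child_distr T v).
  move=> ntv; apply/(valid_moveP P _ (fin v) (flow_gt0 ft v)).
  by exists (m v); first exact: drv.
split; first by exists r; [exact: flow_directed ft|exact: flow_root ft].
split=> //.
- by move=> v; rewrite (flow_gt0 ft) (flow_le1 ft).
- by rewrite leafE => v [].
- rewrite leafE; split=> v.
    move=> [/step[c + st] /= vm].
    by rewrite vm; case: c st => // st _; [left|right].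
  move=> /[dup] ntv /step[c + st] nvm.
  have /negP/negbTE -> : ~ consumes (t v) (m v) by move=> vm; apply: nvm.
  by case: c st => // st _; [left|right].
move=> w wE n; have [k nk km] := inf w wE n; exists k => //.
by split=> //; exact: not_tip (wE k).
Qed.

End Derivations.
Arguments move : clear implicits.

Lemma iASTP (R : realType) (Sg : signature) (V : Type) (P : set (adp R Sg V)) :
  adp_problem P ->
  iAST P <-> forall (N : choiceType) (E : N -> N -> Prop) r p t m,
    flow_tree E r p -> derivation P E p t m ->
    infinite_path E `<=` infinitely_often (consuming t m) ->
    leaf_sum E p = 1%E.
Proof.
move=> hP; split=> [ast N E r p t m ft drv inf|sum1 N T].
  have := ast _ _ (derivation_chain_tree ft drv inf).
  by rewrite /leaf_prob leafE.
move=> /(chain_tree_derivation hP)[r [m [ft drv inf]]].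
by rewrite /leaf_prob leafE; exact: sum1 ft drv inf.
Qed.

Section PrunedDerivation.
Context {R : realType} {Sg : signature} {V : Type} {N : choiceType}.
Variables (P : set (adp R Sg V)) (E : N -> N -> Prop) (r : N) (p : N -> R).
Variables (t : N -> aterm Sg V) (m : N -> move R Sg V N).
Hypothesis ft : flow_tree E r p.

Definition pruned_moves u cut (a : pruned E u cut) :
    move R Sg V (pruned E u cut) :=
  Move (m (val a)) (pick (m (val a)) \o val).

Lemma derivation_pruned u cut :
  (forall v, kept E u cut v -> ~ tip E v -> valid_move P E p t v (m v)) ->
  derivation P (pruned_edge E u cut) (pruned_prob E p u cut) (t \o val)
    (@pruned_moves u cut).
Proof.
move=> drv a; rewrite tip_pruned => /not_orP[nta nca].
have [red perm pE tE] := drv _ (kept_val a) nta; split=> //.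
- have := perm_map (pick (m (val a))) (perm_pruned_edge ft nca).
  by rewrite -map_comp => /permPl ->.
- by move=> b [ab _]; rewrite /pruned_prob pE// mulrAC.
- by move=> b [ab _]; exact: tE.
Qed.

Lemma iAST_null_consuming : adp_problem P -> iAST P -> derivation P E p t m ->
  null E r p (infinite_path E `&` infinitely_often (consuming t m)).
Proof.
move=> hP /(iASTP hP) ast drv; apply: (null_infinitely_often ft) => cut inf.
have drv_pruned := derivation_pruned (u := r) (cut := cut) (fun v _ => drv v).
apply: ast (flow_tree_pruned r cut ft) drv_pruned _.
by move=> w wE; exact: (inf (val \o w) wE).
Qed.

End PrunedDerivation.

(** * Relabelled derivations *)

Section Relabelling.
Context {R : realType} {Sg : signature} {V : Type} {N : choiceType}.
Variables (E : N -> N -> Prop) (r : N) (p : N -> R).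
Implicit Types (P : set (adp R Sg V)) (v : N).

(* The move [m'] contracts the same redex as [m], by an ADP of [P] that differs
   from that of [m] only in its annotations. *)
Definition replays P v (m m' : move R Sg V N) : Prop :=
  [/\ P (rule m') /\
        perm_eq [seq pick m' w | w <- fset_set (E v)] (rhs (rule m')),
      lhs (rule m') = lhs (rule m) /\ flag (rule m') = flag (rule m),
      matcher m' = matcher m /\ position m' = position m
    & forall w, E v w -> (pick m' w).1 = (pick m w).1 /\
        flat (pick m' w).2 = flat (pick m w).2].

Variables (t : N -> aterm Sg V) (u : N) (m m' : N -> move R Sg V N).

(* The labels recomputed with the moves [m'] from [u] downwards; only the
   values at the descendants of [u] are meaningful. *)
Definition relabel : N -> aterm Sg V :=
  tree_rec E r (t r) (fun v w s =>
    if w == u then t u else reduct s (m' v) (pick (m' v) w).2).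

Variables P P' : set (adp R Sg V).
Hypotheses (hP : adp_problem P) (hP' : adp_problem P').
Hypothesis lhsP' : @lhs R Sg V @` P' = @lhs R Sg V @` P.
Hypothesis ft : flow_tree E r p.
Let tree : directed_tree E r := flow_directed ft.
Hypothesis drv : derivation P E p t m.
Hypothesis rep : forall v, ~ tip E v -> replays P' v (m v) (m' v).

Lemma relabel_start : relabel u = t u.
Proof.
rewrite /relabel; case du: (depth E r u) => [|n].
  by rewrite (depth_eq0 tree du) (tree_rec_root tree).
by have [v vu _] := depth_eqS tree du; rewrite (tree_rec_edge tree _ _ vu) eqxx.
Qed.

Lemma relabel_edge v w : (depth E r u <= depth E r v)%N -> E v w ->
  relabel w = reduct (relabel v) (m' v) (pick (m' v) w).2.
Proof.
move=> uv vw; rewrite /relabel (tree_rec_edge tree _ _ vw); case: eqP => // wu.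
by move: uv; rewrite -wu (depth_edge tree vw) ltnn.
Qed.

Lemma flat_relabel v : flat (relabel v) = flat (t v).
Proof.
move: v; apply: (tree_ind tree) => [|v w vw IH].
  by rewrite /relabel (tree_rec_root tree).
rewrite /relabel (tree_rec_edge tree _ _ vw) -/relabel; case: eqP => [->//|_].
have [_ _ [matchE posE] /(_ w vw)[_ pickE]] := rep (not_tip vw).
have [_ _ _ tE] := drv (not_tip vw).
by rewrite tE// !flat_reduct IH matchE posE pickE.
Qed.

Lemma valid_move_relabel v : (depth E r u <= depth E r v)%N -> ~ tip E v ->
  valid_move P' E p relabel v (m' v).
Proof.
move=> uv ntv.
have [[P'v perm] [lhsE _] [matchE posE] pickE] := rep ntv.
have [/(reducesP hP)[_ sub anf] _ pE _] := drv ntv.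
split=> // [|w vw|w vw].
- apply/(reducesP hP'); rewrite flat_relabel /redex_term lhsE matchE posE.
  by split=> //; move: anf; rewrite /ANF /adp_nf lhsP'.
- by rewrite pE// (pickE w vw).1.
- exact: relabel_edge.
Qed.

Lemma annotated_relabel :
  (forall v w q, E v w -> annotated (pick (m v) w).2 q ->
    annotated (pick (m' v) w).2 q) ->
  forall v q, annotated (t v) q -> annotated (relabel v) q.
Proof.
move=> pick_annotated; apply: (tree_ind tree) => [q|v w vw IH q].
  by rewrite /relabel (tree_rec_root tree).
rewrite /relabel (tree_rec_edge tree _ _ vw) -/relabel; case: eqP => [->//|_].
have [_ [_ flagE] [_ posE] _] := rep (not_tip vw).
have [/(reducesP hP)[_ sub _] _ _ tE] := drv (not_tip vw).
rewrite tE// !annotated_reduct ?posE ?flat_relabel ?sub// flagE.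
by case: ifP => _ /andP[av ax]; apply/andP; split=> //;
  [rewrite /consumes posE; exact: IH|exact: pick_annotated|exact: IH].
Qed.

End Relabelling.

(** * Flattening the ADPs outside a set *)

Section FlatOutside.
Context {R : realType} {Sg : signature} {V : Type}.
Implicit Types (P Q : set (adp R Sg V)) (a : adp R Sg V) (x : R * aterm Sg V).

Definition flat_outside P Q : set (adp R Sg V) :=
  Q `|` (@flat_adp R Sg V) @` (P `\` Q).

Definition flat_elt x : R * aterm Sg V := (x.1, emb (flat x.2)).

Definition flat_outside_adp Q a : adp R Sg V :=
  if `[< Q a >] then a else flat_adp a.

Definition flat_outside_elt Q a x : R * aterm Sg V :=
  if `[< Q a >] then x else flat_elt x.

Definition flat_outside_reduction Q (d : reduction R Sg V) : reduction R Sg V :=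
  Reduction (flat_outside_adp Q (rule d)) (matcher d) (position d).

Lemma lhs_flat_outside_adp Q a : lhs (flat_outside_adp Q a) = lhs a.
Proof. by rewrite /flat_outside_adp; case: ifP. Qed.

Lemma flag_flat_outside_adp Q a : flag (flat_outside_adp Q a) = flag a.
Proof. by rewrite /flat_outside_adp; case: ifP. Qed.

Lemma prob_flat_outside_elt Q a x : (flat_outside_elt Q a x).1 = x.1.
Proof. by rewrite /flat_outside_elt; case: ifP. Qed.

Lemma flat_flat_outside_elt Q a x : flat (flat_outside_elt Q a x).2 = flat x.2.
Proof. by rewrite /flat_outside_elt; case: ifP => //= _; rewrite flat_emb. Qed.

Lemma mem_flat_outside_adp P Q a :
  P a -> flat_outside P Q (flat_outside_adp Q a).
Proof.
move=> Pa; rewrite /flat_outside_adp.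
by case: asboolP => Qa; [left|right; exists a].
Qed.

Lemma lhs_flat_outside P Q : Q `<=` P ->
  @lhs R Sg V @` flat_outside P Q = @lhs R Sg V @` P.
Proof.
move=> QP; apply/seteqP; split=> [_ [a [Qa|[b [Pb _] <-]] <-]|_ [a Pa <-]].
- by exists a => //; exact: QP.
- by exists b.
- by exists (flat_outside_adp Q a);
    [exact: mem_flat_outside_adp|exact: lhs_flat_outside_adp].
Qed.

Lemma is_adp_flat a : is_adp a -> is_adp (flat_adp a).
Proof.
move=> [root [prob01 sum1] rhs_vars]; split=> //; first split=> [x|].
- by rewrite (perm_mem (perm_eq_seq_mset _)) => /mapP[y /prob01 ? ->].
- by rewrite (perm_big _ (perm_eq_seq_mset _)) /= big_map sum1.
move=> x; rewrite (perm_mem (perm_eq_seq_mset _)) => /mapP[y /rhs_vars yv ->].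
by rewrite /= vars_emb vars_flat.
Qed.

Lemma adp_problem_flat_outside P Q :
  adp_problem P -> Q `<=` P -> adp_problem (flat_outside P Q).
Proof.
move=> [finP adpP] QP; split.
  rewrite finite_setU; split; first exact: sub_finite_set finP.
  by apply: finite_image; apply: sub_finite_set finP => a [].
by move=> a [/QP/adpP//|[b [/adpP Pb _] <-]]; exact: is_adp_flat.
Qed.

End FlatOutside.

(** * Strongly connected components *)

Lemma clos_t_rt (T : Type) (e : T -> T -> Prop) x y z :
  clos_trans T e x y -> clos_refl_trans T e y z -> clos_trans T e x z.
Proof.
move=> xy /clos_rt_rtn1_iff; elim=> // y' z' yz' _ xy'.
by apply: t_trans xy' _; exact: t_step.
Qed.

Section Components.
Context {R : realType} {Sg : signature} {V : Type}.
Variable P : set (adp R Sg V).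
Implicit Types (a b c : adp R Sg V) (Q : set (adp R Sg V)).
Local Notation reaches := (clos_trans _ (dg_edge P)).

Definition scc a : set (adp R Sg V) := [set b | reaches a b /\ reaches b a].

Lemma scc_sub a : scc a `<=` P.
Proof. by move=> b [_]; elim=> [c d []|]. Qed.

Lemma strongly_connected_scc a : strongly_connected P (scc a).
Proof.
move=> b c [ab ba] [ac ca].
have /clos_trans_t1n_iff : reaches b c by apply: t_trans ba ac.
move=> bc; elim: bc ab ba ac ca => [e f ef *|e f g ef fg IH ae ea ag ga].
  exact: t_step.
have {}fg : reaches f g by apply/clos_trans_t1n_iff.
have af : reaches a f by apply: t_trans ae _; exact: t_step.
have fa : reaches f a by apply: t_trans fg ga.
by apply: t_trans (IH af fa ag ga); apply: t_step.
Qed.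

Lemma sub_scc Q a : strongly_connected P Q -> Q a -> Q `<=` scc a.
Proof.
move=> scQ Qa b Qb.
have forget c1 c2 :
    clos_trans _ (fun a1 a2 => [/\ Q a1, Q a2 & dg_edge P a1 a2]) c1 c2 ->
    reaches c1 c2.
  by elim=> [a1 a2 [_ _]|a1 a2 a3 _ + _]; [exact: t_step|exact: t_trans].
by split; apply: forget; exact: scQ.
Qed.

Lemma SCC_scc a : reaches a a -> SCC P (scc a).
Proof.
move=> aa; split; first by exists a.
- exact: scc_sub.
- exact: strongly_connected_scc.
move=> Q' sccQ' _ scQ'; apply/seteqP; split=> //.
by apply: sub_scc => //; exact: sccQ'.
Qed.

Lemma SCC_eq_scc Q a : SCC P Q -> Q a -> Q = scc a.
Proof.
move=> [_ _ scQ maxQ] Qa; apply/esym/maxQ.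
- exact: sub_scc.
- exact: scc_sub.
- exact: strongly_connected_scc.
Qed.

Lemma finite_SCC : finite_set P -> finite_set [set Q | SCC P Q].
Proof.
move=> /(finite_image scc); apply: sub_finite_set => Q SCCQ.
have [[a Qa] QP _ _] := SCCQ.
by exists a; [exact: QP|rewrite -(SCC_eq_scc SCCQ Qa)].
Qed.

End Components.

(** * Rewrite sequences and the dependency graph *)

Section RewriteSequences.
Context {R : realType} {Sg : signature} {V : Type}.
Implicit Types (j k m n : nat) (q : seq nat) (a : adp R Sg V).

Lemma sharp_step (P : set (adp R Sg V)) (y : uterm Sg V) q a
    (sigma : V -> uterm Sg V) (z : R * aterm Sg V) : q != [::] ->
  P a -> flag a -> z \in rhs a ->
  subterm_at y q = Some (subst sigma (lhs a)) ->
  ANF P (emb (subst sigma (lhs a))) ->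
  innermost_step (np P) (sharp y)
    (sharp (replace y q (subst sigma (flat z.2)))).
Proof.
move=> q0 Pa fa za yq anf.
exists (emb (lhs a)), (emb (flat z.2)), (emb \o sigma), q; split.
- by exists a, z.
- by rewrite subterm_at_sharp// yq /= emb_subst.
- move=> q' u q'0; rewrite -emb_subst => /(anf _ _ q'0) nf q2 u2 uq2.
  move=> [l [tau [[_ [b [z' [Pb _ _ ->]]] /= <-] u2E]]].
  apply: (nf q2 (flat u2)); first by rewrite subterm_at_flat uq2.
  exists (lhs b), (@flat Sg V \o tau); split; first by exists b.
  by rewrite u2E flat_subst flat_emb.
- by rewrite sharp_replace// emb_subst.
Qed.

Variable P : set (adp R Sg V).
Hypothesis hP : adp_problem P.
Variables (t : nat -> aterm Sg V) (d : nat -> reduction R Sg V).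
Variable x : nat -> R * aterm Sg V.

Definition rewrite_sequence : Prop := forall n,
  [/\ reduces P (t n) (d n), x n \in rhs (rule (d n))
    & t n.+1 = reduct (t n) (d n) (x n).2].

Hypothesis rewr : rewrite_sequence.
Local Notation consumed n := (consumes (t n) (d n)).
Local Notation above m n := (prefix (position (d m)) (position (d n))).
Local Notation reaches := (clos_refl_trans _ (dg_edge P)).

(* Step [m] is the last one before [n] at or above the position of step [n]; if
   step [n] consumes an annotation, then step [m] created it. *)
Definition last_above m n : Prop :=
  [/\ (m < n)%N, above m n & forall j, (m < j < n)%N -> ~~ above j n].

Lemma rule_in_problem n : P (rule (d n)).
Proof. by have [/(reducesP hP)[]] := rewr n. Qed.

Lemma redex_at n :
  subterm_at (flat (t n)) (position (d n)) = Some (redex_term (d n)).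
Proof. by have [/(reducesP hP)[]] := rewr n. Qed.

Lemma redex_ANF n : ANF P (emb (redex_term (d n))).
Proof. by have [/(reducesP hP)[]] := rewr n. Qed.

Lemma flat_next n : flat (t n.+1) =
  replace (flat (t n)) (position (d n)) (subst (matcher (d n)) (flat (x n).2)).
Proof. by have [_ _ ->] := rewr n; rewrite flat_reduct. Qed.

Lemma annotated_next n q : annotated (t n.+1) q =
  if prefix (position (d n)) q
  then consumed n && annotated (x n).2 (drop (size (position (d n))) q)
  else annotated (t n) q && (flag (rule (d n)) || ~~ prefix q (position (d n))).
Proof. by have [_ _ ->] := rewr n; rewrite annotated_reduct// redex_at. Qed.

Lemma annotated_before q k n : (k <= n)%N ->
  (forall j, (k <= j < n)%N -> ~~ prefix (position (d j)) q) ->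
  annotated (t n) q -> annotated (t k) q.
Proof.
elim: n => [|n IH]; first by rewrite leqn0 => /eqP ->.
rewrite leq_eqVlt => /predU1P[->//|kn] not_above; rewrite annotated_next.
rewrite (negbTE (not_above n _)) ?ltnSn ?andbT// => /andP[an _].
by apply: IH => // j /andP[kj jn]; apply: not_above; rewrite kj ltnW.
Qed.

Lemma eventually_last_above K : exists K', forall n,
  (K' <= n)%N -> consumed n -> exists2 m, (K <= m)%N & last_above m n.
Proof.
pose orphan := [set n | [/\ consumed n, (K <= n)%N &
  forall j, (K <= j < n)%N -> ~~ above j n]].
have /existsNP[B BP] : ~ unbounded orphan.
  move=> /unboundedP; apply.
  have pos_inj : {in orphan &, injective (position \o d)}.
    move=> i j /set_mem[_ Ki i_orphan] /set_mem[_ Kj j_orphan] /= ij.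
    have [lt_ij|lt_ji|//] := ltngtP i j.
      by have := j_orphan i; rewrite Ki lt_ij ij prefix_refl => /(_ isT).
    by have := i_orphan j; rewrite Kj lt_ji ij prefix_refl => /(_ isT).
  rewrite -(eq_finite_set (inj_card_eq pos_inj)).
  apply: sub_finite_set (finite_positions (t K)).
  move=> _ [n [cn Kn n_orphan] <-] tKn.
  by have := annotated_before Kn n_orphan cn; rewrite /annotated /sym_at tKn.
exists (maxn B K) => n; rewrite geq_max => /andP[Bn Kn] cn.
pose candidate j := [&& (K <= j)%N, (j < n)%N & above j n].
have ex_candidate : exists j, candidate j.
  apply: contrapT => none; apply: BP; exists n => //; split=> // j /andP[Kj jn].
  by apply/negP => pj; apply: none; exists j; apply/and3P.
have candidate_le j : candidate j -> (j <= n)%N by case/and3P => _ /ltnW.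
case: (ex_maxnP ex_candidate candidate_le) => m /and3P[Km mn pm] m_max.
exists m => //; split=> // j /andP[mj jn]; apply/negP => pj.
have /m_max : candidate j by apply/and3P; rewrite (leq_trans Km (ltnW mj)).
by rewrite leqNgt mj.
Qed.

Section Creation.
Variables m n : nat.
Hypotheses (mn : last_above m n) (cn : consumed n).

Lemma annotated_between k : (m < k <= n)%N -> annotated (t k) (position (d n)).
Proof.
move=> /andP[mk kn]; have [_ _ not_above] := mn.
apply: annotated_before kn _ cn => j /andP[kj jn].
by apply: not_above; rewrite (leq_trans mk kj).
Qed.

Lemma flag_between k : (m < k < n)%N ->
  flag (rule (d k)) || ~~ prefix (position (d n)) (position (d k)).
Proof.
move=> mkn; have [_ _ /(_ k mkn)/negbTE not_above] := mn.
have /annotated_between : (m < k.+1 <= n)%N by lia.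
by rewrite annotated_next not_above => /andP[].
Qed.

Lemma last_above_creates : consumed m /\
  annotated (x m).2 (drop (size (position (d m))) (position (d n))).
Proof.
have [lt_mn above_mn _] := mn.
have /annotated_between : (m < m.+1 <= n)%N by rewrite ltnSn.
by rewrite annotated_next above_mn => /andP.
Qed.

Lemma sharp_steps_between q u k : position (d n) = position (d m) ++ q ->
  subterm_at (x m).2 q = Some u -> (m < k <= n)%N ->
  exists2 y, subterm_at (flat (t k)) (position (d n)) = Some y &
    clos_refl_trans _ (innermost_step (np P))
      (sharp (subst (matcher (d m)) (flat u))) (sharp y).
Proof.
move=> posE xu /andP[+ +]; elim: k => [//|k IH].
rewrite ltnS leq_eqVlt => /predU1P[<-|mk] kn.
  exists (subst (matcher (d m)) (flat u)); last exact: rt_refl.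
  rewrite flat_next posE subterm_at_replace ?redex_at//.
  by apply: subterm_at_subst; rewrite subterm_at_flat xu.
have [y yk steps] := IH mk (ltnW kn).
have mkn : (m < k < n)%N by rewrite mk.
have [_ _ /(_ k mkn) not_above] := mn.
have := flag_between mkn; rewrite flat_next.
case: (boolP (prefix (position (d n)) (position (d k)))) => [|below].
  rewrite orbF => /prefixP[q' posk] fk.
  rewrite posk subterm_at_replace_above yk /=; eexists; first by [].
  apply: rt_trans steps _; apply: rt_step.
  have [_ xk _] := rewr k; apply: (sharp_step _ (rule_in_problem k)) => //.
  - by apply: contra not_above => /eqP q'0; rewrite posk q'0 cats0 prefix_refl.
  - by have := redex_at k; rewrite posk subterm_at_cat yk.
  - exact: redex_ANF.
by exists y => //; rewrite subterm_at_replace_parallel.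
Qed.

Lemma last_above_dg_edge : dg_edge P (rule (d m)) (rule (d n)).
Proof.
split; first exact: rule_in_problem.
split; first exact: rule_in_problem.
have [lt_mn /prefixP[q posE] _] := mn.
have [_] := last_above_creates; rewrite posE drop_size_cat// => xq.
have [u [f [xu uf]]] := annotated_subterm xq.
have [|y] := sharp_steps_between (k := n) posE xu; first by rewrite lt_mn leqnn.
rewrite redex_at => -[<-] steps; have [_ xm _] := rewr m.
have [g ng] := problem_lhs_root hP (rule_in_problem n).
exists (matcher (d m)), (matcher (d n)), (x m), (flat u); split=> //.
- by exists q, u; split=> //; exact/pos_annotP.
- by rewrite (asubst_sharp _ uf) (asubst_sharp _ ng).
- exact: redex_ANF.
- exact: redex_ANF.
Qed.

End Creation.

Definition consuming_steps a : set nat :=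
  [set n | consumed n /\ rule (d n) = a].

Definition recurrent : set (adp R Sg V) :=
  [set a | unbounded (consuming_steps a)].

Lemma eventually_recurrent :
  exists K, forall n, (K <= n)%N -> consumed n -> recurrent (rule (d n)).
Proof.
have [|K KP] := @eventually_unbounded_fiber _ [set n | consumed n] (rule \o d).
  by apply: sub_finite_set hP.1 => _ [n _ <-]; exact: rule_in_problem.
by exists K => n Kn cn; exact: KP.
Qed.

Lemma exists_minimal_recurrent : unbounded [set n | consumed n] ->
  exists2 a, recurrent a & forall b, recurrent b -> reaches b a -> reaches a b.
Proof.
move=> inf; apply: finite_set_minimal; [exact: rt_refl|exact: rt_trans| |].
  apply: sub_finite_set hP.1 => b /(_ 0%N)[n _ [_ <-]].
  exact: rule_in_problem.
have [K KP] := eventually_recurrent; have [n Kn cn] := inf K.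
by exists (rule (d n)); exact: KP.
Qed.

Definition self_created K Q : Prop := forall n,
  (K <= n)%N -> consumed n -> Q (rule (d n)) ->
  exists2 m, last_above m n & Q (rule (d m)).

(* Take for [Q] the SCC of an ADP that is minimal for reachability among those
   that consume annotations infinitely often: from some step on, the annotations
   consumed by [Q] are created by [Q]. *)
Lemma exists_recurrent_SCC : unbounded [set n | consumed n] ->
  exists K Q, [/\ SCC P Q, unbounded [set n | consumed n /\ Q (rule (d n))]
    & self_created K Q].
Proof.
move=> /exists_minimal_recurrent[a rec_a min_a].
have [K0 K0P] := eventually_recurrent; have [K KP] := eventually_last_above K0.
have created n : (K <= n)%N -> consumed n -> reaches (rule (d n)) a ->
    exists m, [/\ last_above m n, reaches a (rule (d m)) &
      dg_edge P (rule (d m)) (rule (d n))].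
  move=> Kn cn na; have [m K0m mn] := KP n Kn cn; exists m.
  have edge := last_above_dg_edge mn cn.
  have [cm _] := last_above_creates mn cn.
  split=> //; apply: min_a (K0P m K0m cm) _.
  by apply: rt_trans na; exact: rt_step.
have aa : clos_trans _ (dg_edge P) a a.
  have [n Kn [cn na]] := rec_a K.
  have [|m [_ am]] := created n Kn cn; first by rewrite na; exact: rt_refl.
  by rewrite na => ma; apply: clos_rt_t am _; exact: t_step.
exists K, (scc P a); split.
- exact: SCC_scc.
- move=> k; have [n kn [cn na]] := rec_a k; exists n => //.
  by split; rewrite ?na.
move=> n Kn cn [_ na_trans].
have na : reaches (rule (d n)) a by exact: clos_t_clos_rt.
have [m [mn am edge]] := created n Kn cn na; exists m => //.
by split; [exact: clos_t_rt am|apply: clos_t_rt na; exact: t_step].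
Qed.

Definition restarts K Q (s : nat -> aterm Sg V) : Prop :=
  s K = t K /\ forall n, (K <= n)%N ->
    s n.+1 = reduct (s n) (flat_outside_reduction Q (d n))
      (flat_outside_elt Q (rule (d n)) (x n)).2.

Section Restart.
Variables (K : nat) (Q : set (adp R Sg V)) (s : nat -> aterm Sg V).
Hypotheses (selfQ : self_created K Q) (sK : restarts K Q s).
Let s_start : s K = t K := sK.1.
Let s_next := sK.2.

Lemma flat_restart n : (K <= n)%N -> flat (s n) = flat (t n).
Proof.
elim: n => [|n IH]; first by rewrite leqn0 => /eqP K0; rewrite -K0 s_start.
rewrite leq_eqVlt => /predU1P[<-|Kn]; first by rewrite s_start.
by rewrite s_next// flat_reduct flat_next IH// flat_flat_outside_elt.
Qed.

Lemma annotated_restart_next n q : (K <= n)%N -> annotated (s n.+1) q =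
  if prefix (position (d n)) q
  then consumes (s n) (d n) &&
    annotated (flat_outside_elt Q (rule (d n)) (x n)).2
      (drop (size (position (d n))) q)
  else annotated (s n) q && (flag (rule (d n)) || ~~ prefix q (position (d n))).
Proof.
move=> Kn; rewrite s_next// annotated_reduct ?flat_restart ?redex_at//=.
by rewrite flag_flat_outside_adp.
Qed.

Lemma annotated_restart_after m n j : last_above m n -> consumed n ->
  (K <= j)%N -> (m < j <= n)%N -> annotated (s j) (position (d n)) ->
  consumes (s n) (d n).
Proof.
move=> mn cn Kj /andP[mj jn] sj; have [_ _ not_above] := mn.
suff persists k : (j <= k)%N -> (k <= n)%N -> annotated (s k) (position (d n)).
  exact: persists.
elim: k => [|k IH]; first by rewrite leqn0 => /eqP j0; rewrite -j0.
rewrite leq_eqVlt => /predU1P[<-//|jk] kn.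
have mkn : (m < k < n)%N by rewrite (leq_trans mj).
rewrite annotated_restart_next ?(leq_trans Kj)// (negbTE (not_above k mkn)).
by rewrite IH ?(ltnW kn)//=; exact: flag_between mn cn _ mkn.
Qed.

Lemma restart_consumes n : (K <= n)%N -> consumed n -> Q (rule (d n)) ->
  consumes (s n) (d n).
Proof.
elim/ltn_ind: n => n IH Kn cn Qn.
have [m mn Qm] := selfQ Kn cn Qn.
have [lt_mn above_mn _] := mn; have [cm xm] := last_above_creates mn cn.
have [Km|mK] := leqP K m.
  apply: (annotated_restart_after (j := m.+1) mn cn); rewrite ?ltnSn//.
    exact: leqW.
  by rewrite annotated_restart_next// above_mn IH//= /flat_outside_elt asboolT.
apply: (annotated_restart_after (j := K) mn cn); rewrite ?mK//.
by rewrite s_start; apply: (annotated_between mn cn); rewrite mK.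
Qed.

End Restart.

Lemma exists_SCC_restart : unbounded [set n | consumed n] ->
  exists K Q, SCC P Q /\ forall s, restarts K Q s ->
    unbounded [set n | (K <= n)%N /\ consumes (s n) (d n)].
Proof.
move=> /exists_recurrent_SCC[K [Q [SCCQ infQ selfQ]]].
exists K, Q; split=> // s sK k.
have [n] := infQ (maxn K k); rewrite geq_max => /andP[Kn kn] [cn Qn].
by exists n => //; split=> //; exact: (restart_consumes selfQ sK).
Qed.

End RewriteSequences.

(** * Soundness and completeness of the processor *)

Section Processor.
Context {R : realType} {Sg : signature} {V : Type}.
Variables P Q : set (adp R Sg V).
Hypotheses (hP : adp_problem P) (QP : Q `<=` P).

Section Moves.
Context {N : choiceType}.
Implicit Types (E : N -> N -> Prop) (p : N -> R) (v : N) (m : move R Sg V N).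

Definition flat_outside_move m : move R Sg V N :=
  Move (flat_outside_reduction Q m) (flat_outside_elt Q (rule m) \o pick m).

Lemma replays_flat_outside E p t v m : valid_move P E p t v m ->
  replays E (flat_outside P Q) v m (flat_outside_move m).
Proof.
move=> [/(reducesP hP)[Pm _ _] perm _ _]; split=> //=.
- split; first exact: mem_flat_outside_adp.
  rewrite map_comp (permPl (perm_map _ perm)) /flat_outside_adp.
  rewrite /flat_outside_elt; case: asboolP => _; first by rewrite map_id.
  by rewrite perm_sym; exact: perm_eq_seq_mset.
- by rewrite lhs_flat_outside_adp flag_flat_outside_adp.
- by move=> w _; rewrite prob_flat_outside_elt flat_flat_outside_elt.
Qed.

Lemma replays_unflatten E p t v m : finite_set (E v) ->
  valid_move (flat_outside P Q) E p t v m ->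
  exists2 m', replays E P v m m' & forall w q, E v w ->
    annotated (pick m w).2 q -> annotated (pick m' w).2 q.
Proof.
move=> fin [/(reducesP (adp_problem_flat_outside hP QP))[Qm _ _] perm _ _].
case: Qm => [Qm|[b [Pb _] bm]].
  by exists m => //; split=> //; split=> //; exact: QP.
move: perm; rewrite -bm (permPr (perm_eq_seq_mset _)).
move=> /(perm_map_factor (0, t v) (fset_uniq _))[f perm fE].
have pickE w : E v w -> pick m w = flat_elt (f w).
  by move=> vw; apply: fE; rewrite in_fset_set ?inE.
exists (Move (Reduction b (matcher m) (position m)) f).
  by split=> //= [|w /pickE ->]; rewrite -?bm//= flat_emb.
by move=> w q /pickE ->; rewrite annotated_emb.
Qed.

End Moves.

Lemma iAST_flat_outside : iAST P -> iAST (flat_outside P Q).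
Proof.
have hPQ := adp_problem_flat_outside hP QP.
move=> /(iASTP hP) ast; apply/(iASTP hPQ) => N E r p t m ft drv inf.
have /choice[m' m'P] v : exists m', ~ tip E v -> replays E P v (m v) m' /\
    forall w q, E v w ->
      annotated (pick (m v) w).2 q -> annotated (pick m' w).2 q.
  have [tv|ntv] := pselect (tip E v); first by exists (m v).
  by have [m'] := replays_unflatten (flow_finite ft v) (drv v ntv); exists m'.
have rep v : ~ tip E v -> replays E P v (m v) (m' v) by move=> /m'P[].
have drv' : derivation P E p (relabel E r t r m') m'.
  move=> v; apply: (valid_move_relabel hPQ hP _ ft drv rep).
    by rewrite lhs_flat_outside.
  by rewrite (depth_root (flow_directed ft)).
apply: (ast _ _ _ _ _ _ ft drv') => w wE n.
have [k nk km] := inf w wE n; exists k => //.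
have [_ _ [_ posE] _] := rep _ (not_tip (wE k)).
rewrite /consuming /consumes /= posE.
apply: (annotated_relabel r hPQ ft drv rep) => // [v w' q vw'].
by have [_] := m'P _ (not_tip vw'); apply.
Qed.

Section RestartedTree.
Context {N : choiceType}.
Variables (E : N -> N -> Prop) (r : N) (p : N -> R).
Variables (t : N -> aterm Sg V) (m : N -> move R Sg V N) (u : N).
Hypotheses (ft : flow_tree E r p) (drv : derivation P E p t m).

Definition restart : N -> aterm Sg V :=
  relabel E r t u (flat_outside_move \o m).

Definition restart_paths : set (nat -> N) :=
  [set w | infinite_path E w /\ exists2 K, w K = u &
    unbounded [set n | (K <= n)%N /\ consumes (restart (w n)) (m (w n))]].

Lemma null_restart_paths : iAST (flat_outside P Q) -> null E r p restart_paths.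
Proof.
have hPQ := adp_problem_flat_outside hP QP; move=> ast.
pose m' := flat_outside_move \o m.
have drv' : derivation (flat_outside P Q) (pruned_edge E u set0)
    (pruned_prob E p u set0) (restart \o val)
    (@pruned_moves _ _ _ _ E m' u set0).
  apply: (derivation_pruned ft) => v kv ntv.
  apply: (valid_move_relabel hP hPQ _ ft drv) => //.
  - exact: lhs_flat_outside.
  - by move=> v' ntv'; exact: replays_flat_outside (drv ntv').
  - exact: (kept_depth ft kv).
apply: sub_null (null_subtree ft
  (iAST_null_consuming (flow_tree_pruned u set0 ft) hPQ ast drv')).
move=> w [wE [K wK inf]].
have wE0 : infinite_path (uncut_edge E set0) (fun n => w (K + n)%N).
  by move=> n; rewrite addnS; split; [exact: wE|].
have wK0 : w (K + 0)%N = u by rewrite addn0.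
exists K; exists (fun n => pruned_node (kept_path wK0 wE0 n)) => //.
split=> [n|n]; first exact: wE0.
have [k Knk [Kk ck]] := inf (K + n)%N; exists (k - K)%N.
  by rewrite leq_subRL.
by rewrite /consuming /= subnKC.
Qed.

End RestartedTree.
End Processor.

Lemma iAST_of_SCC (R : realType) (Sg : signature) (V : Type)
    (P : set (adp R Sg V)) : adp_problem P ->
  (forall Q, SCC P Q -> iAST (flat_outside P Q)) -> iAST P.
Proof.
move=> hP astQ; apply/(iASTP hP) => N E r p t m ft drv inf.
have tree := flow_directed ft.
apply: (null_infinite_path_leaf_sum1 ft).
apply: sub_null (null_bigcup (A := fun uQ => restart_paths uQ.2 E r t m uQ.1) ft
  (countableX (countable_nodes ft) (finite_set_countable (finite_SCC hP.1))) _).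
  move=> w [w0 wE].
  have rewr : rewrite_sequence P (t \o w) (m \o w)
      (fun n => pick (m (w n)) (w n.+1)).
    move=> n; have [red perm _ tE] := drv _ (not_tip (wE n)).
    split=> //; last exact: tE.
    rewrite -(perm_mem perm); apply: map_f.
    by rewrite in_fset_set ?inE; [exact: wE|exact: flow_finite ft _].
  have [K [Q [SCCQ restartP]]] := exists_SCC_restart hP rewr (inf w wE).
  exists (w K, Q) => //; split=> //; exists K => //.
  apply: (restartP (restart Q E r t m (w K) \o w)); split=> [|n Kn].
    exact: relabel_start ft.
  apply: (relabel_edge _ _ ft) (wE n).
  by rewrite (depth_path tree K wE) (depth_path tree n wE) leq_add2l.
move=> [u Q] [_ SCCQ]; apply: null_restart_paths (astQ _ SCCQ) => //.
by case: SCCQ.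
Qed.

Theorem theorem14 (R : realType) (Sg : signature) (V : Type)
    (P : set (adp R Sg V)) (hP : adp_problem P) :
  iAST P <->
  forall Q : set (adp R Sg V), SCC P Q ->
    iAST (Q `|` (@flat_adp R Sg V) @` (P `\` Q)).
Proof.
split=> [ast Q [_ QP _ _]|]; first exact: iAST_flat_outside.
exact: iAST_of_SCC.
Qed.
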